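(* Let $c(r)=2^{\lfloor (r-2)/2\rfloor}+2^{\lceil (r-2)/2\rceil}-r-1$. Let $l_0,m_0$ be integers with $c(l_0)>0$ and $c(m_0)>0$, and let $l,m$ be integers with $l\ge 5$, $m\ge5$, $l\ge l_0$, $m\ge m_0$. Put $$l_1=c(l_0)\binom{l+m-l_0-m_0}{l-l_0}-1,\qquad m_1=c(m_0)\binom{l+m-l_0-m_0}{m-m_0}-1.$$ Then $f(l,m,l_1,m_1)$ does not exist: for every positive integer $N$ there is a set $\mathcal X$ of at least $N$ points in the plane, in general position and with pairwise distinct $x$-coordinates, which contains no $l$-cup with at most $l_1$ points of $\mathcal X$ inside and no $m$-cap with at most $m_1$ points of $\mathcal X$ inside.
   Context: Fix Cartesian coordinates $(x,y)$ in the plane. Let $\mathcal X$ be a finite set of points in general position (no three collinear) with pairwise distinct $x$-coordinates. A subset $\{(x_{1},y_{1}),\dots,(x_{r},y_{r})\}$ with $x_1<\dots<x_r$ is an $r$-cup if the slopes $\frac{y_{j+1}-y_j}{x_{j+1}-x_j}$, $j=1,\dots,r-1$, are strictly increasing in $j$, and an $r$-cap if they are strictly decreasing. The points of $\mathcal X$ inside a cup or cap are the points of $\mathcal X$ lying in the interior of the convex hull of the cup or cap. $f(l,m,l_1,m_1)$ is the least positive integer (if it exists) such that every such set $\mathcal X$ with at least $f(l,m,l_1,m_1)$ points contains an $l$-cup with at most $l_1$ points of $\mathcal X$ inside or an $m$-cap with at most $m_1$ points of $\mathcal X$ inside.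
   Formalization: The integers l_0 and m_0 are taken to be nonnegative (so c>0 means at least 6); for negative values c is also positive and the claim fails, e.g. l_0=m_0=-1, l=m=5 gives l_1=m_1=692, yet f(5,5,692,692) exists by Erdős–Szekeres. *)

(* Defs.v *)
From Stdlib Require Import Reals Lra Lia ZArith Arith List.
Open Scope R_scope.

Definition point : Type := (R * R)%type.

Definition slope (p q : point) : R := (snd q - snd p) / (fst q - fst p).

Definition orient (p q r : point) : R :=
  (fst q - fst p) * (snd r - snd p) - (snd q - snd p) * (fst r - fst p).

Definition general_position (X : list point) : Prop :=
  forall p q r, In p X -> In q X -> In r X ->
    p <> q -> q <> r -> p <> r -> orient p q r <> 0.

Definition distinct_x (X : list point) : Prop :=
  forall p q, In p X -> In q X -> p <> q -> fst p <> fst q.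

Definition pt0 : point := (0, 0).

Definition sorted_subset (X : list point) (r : nat) (s : list point) : Prop :=
  length s = r /\
  (forall p, In p s -> In p X) /\
  (forall j, (j + 1 < length s)%nat -> fst (nth j s pt0) < fst (nth (j+1) s pt0)).

Definition is_cup (X : list point) (r : nat) (s : list point) : Prop :=
  sorted_subset X r s /\
  forall j, (j + 2 < length s)%nat ->
    slope (nth j s pt0) (nth (j+1) s pt0) < slope (nth (j+1) s pt0) (nth (j+2) s pt0).

Definition is_cap (X : list point) (r : nat) (s : list point) : Prop :=
  sorted_subset X r s /\
  forall j, (j + 2 < length s)%nat ->
    slope (nth j s pt0) (nth (j+1) s pt0) > slope (nth (j+1) s pt0) (nth (j+2) s pt0).

Definition in_hull (s : list point) (p : point) : Prop :=
  exists lam : list R,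
    length lam = length s /\
    (forall a, In a lam -> 0 <= a) /\
    fold_right Rplus 0 lam = 1 /\
    fold_right Rplus 0 (map (fun ab => fst ab * fst (snd ab)) (combine lam s)) = fst p /\
    fold_right Rplus 0 (map (fun ab => fst ab * snd (snd ab)) (combine lam s)) = snd p.

Definition in_hull_interior (s : list point) (p : point) : Prop :=
  exists eps, 0 < eps /\
    forall q : point, (fst q - fst p)^2 + (snd q - snd p)^2 < eps^2 -> in_hull s q.

Definition at_most_inside (X : list point) (s : list point) (k : R) : Prop :=
  forall L : list point, NoDup L ->
    (forall p, In p L -> In p X /\ in_hull_interior s p) ->
    INR (length L) <= k.

Definition floor_half_m2 (r : Z) : Z := Z.div (r - 2) 2.
Definition ceil_half_m2 (r : Z) : Z := (- Z.div (2 - r) 2)%Z.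

Definition cfun (r : nat) : R :=
  powerRZ 2 (floor_half_m2 (Z.of_nat r)) + powerRZ 2 (ceil_half_m2 (Z.of_nat r))
  - INR r - 1.

(* Main.v *)
Require Import Defs.
From Stdlib Require Import Reals Lra Lia ZArith Arith List FinFun.
Import ListNotations.
Open Scope R_scope.

(** Take a Horton set turned by a quarter: x is the van der Corput height, y the index.
    Its left and right halves interleave vertically and are so thin that a cup meeting
    both consists of p points descending steeply on the left and q points ascending
    steeply on the right. Inside a half, a descending cup has at most one point in the
    right sub-half, so dropping its last point doubles the vertical gaps; hence it has at
    least 2^(p-1) - p cells on its inner side, and the cup contains at least
    2^(p-1) + 2^(q-1) - (p + q) > c(p + q) cells. Now replace every point by a much steeper
    increasing Erdos-Szekeres set with C(a+b, a) points, without (a+2)-cups and (b+2)-caps,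
    where a = l - l0 and b = m - m0. Only the last cell of an l-cup can hold several of its
    points, at most a + 1, so the cup meets at least l0 cells and contains more than c(l0)
    cells, each with C(a+b, a) points. Caps are cups after reflection. *)

(** * Chains *)

(** The cells are lists from the outset, and separation is imposed on whole unions of cells, so no
    perturbation argument is needed when points are replaced by sets. The obstacle is that a cup may
    then take several points from one cell. The quarter turn answers it: each side of a cup becomes
    monotone in height, and a descending chain meets an increasing cell at most once, so the whole
    surplus sits on the ascending side. The counting lemmas carry the surplus as parameters [e1]
    (descending side) and [e2] (ascending side); they are used with (0, a) for cups, and with (b, 0)
    on the flipped set for caps. The number 2^(p-1) - p is the sum of 2^k - 1 over k < p-1: if the
    top and bottom cells of a chain have indices differing by g in the left half, exactly g cells of
    the right half lie between them in the parent. The induction therefore tracks this gap together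
    with the count. The floor and ceiling in c come from convexity: the sum of two powers of 2 with
    a given total exponent is least for a balanced split. *)

Definition adj (s : list point) (a b : point) : Prop :=
  exists s1 s2, s = s1 ++ a :: b :: s2.

Definition adj3 (s : list point) (a b c : point) : Prop :=
  exists s1 s2, s = s1 ++ a :: b :: c :: s2.

(** Orientation replaces the comparison of slopes: it involves no division and is multiplied by a
    constant under the affine maps below. Only consecutive triples are constrained, as in the
    definition of a cup. *)
Definition cup_chain (s : list point) : Prop :=
  (forall a b, adj s a b -> fst a < fst b) /\
  (forall a b c, adj3 s a b c -> 0 < orient a b c).

Definition descending (s : list point) : Prop :=
  forall a b, adj s a b -> snd b < snd a.

Lemma adj_app_l s t a b : adj s a b -> adj (s ++ t) a b.
Proof. intros (u & v & ->). exists u, (v ++ t). now rewrite <- app_assoc. Qed.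

Lemma adj_app_r s t a b : adj t a b -> adj (s ++ t) a b.
Proof. intros (u & v & ->). exists (s ++ u), v. now rewrite <- app_assoc. Qed.

Lemma adj3_app_l s t a b c : adj3 s a b c -> adj3 (s ++ t) a b c.
Proof. intros (u & v & ->). exists u, (v ++ t). now rewrite <- app_assoc. Qed.

Lemma adj3_app_r s t a b c : adj3 t a b c -> adj3 (s ++ t) a b c.
Proof. intros (u & v & ->). exists (s ++ u), v. now rewrite <- app_assoc. Qed.

Lemma adj_in s a b : adj s a b -> In a s /\ In b s.
Proof.
  intros (u & v & ->). split; apply in_or_app; right; simpl; auto.
Qed.

Lemma adj_nil a b : ~ adj [] a b.
Proof. intros (u & v & H). now destruct u. Qed.

Lemma adj_single c a b : ~ adj [c] a b.
Proof. intros (u & v & H). destruct u as [|x [|y u]]; discriminate H. Qed.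

Lemma adj_rev_map f s a b :
  adj (rev (map f s)) a b -> exists a' b', a = f a' /\ b = f b' /\ adj s b' a'.
Proof.
  intros (u & v & H).
  assert (E : map f s = rev v ++ b :: a :: rev u).
  { rewrite <- (rev_involutive (map f s)), H, rev_app_distr. simpl.
    now rewrite <- !app_assoc. }
  apply map_eq_app in E. destruct E as (s1 & s2 & -> & E1 & E2).
  destruct s2 as [|x [|y s2]]; try discriminate E2.
  injection E2 as <- <- _. exists y, x. repeat split. now exists s1, s2.
Qed.

Lemma adj_map f s a b :
  adj (map f s) a b -> exists a' b', a = f a' /\ b = f b' /\ adj s a' b'.
Proof.
  intros (u & v & H).
  apply map_eq_app in H. destruct H as (s1 & s2 & -> & E1 & E2).
  destruct s2 as [|x [|y s2]]; try discriminate E2.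
  injection E2 as <- <- _. exists x, y. repeat split. now exists s1, s2.
Qed.

Lemma adj3_rev_map f s a b c :
  adj3 (rev (map f s)) a b c ->
  exists a' b' c', a = f a' /\ b = f b' /\ c = f c' /\ adj3 s c' b' a'.
Proof.
  intros (u & v & H).
  assert (E : map f s = rev v ++ c :: b :: a :: rev u).
  { rewrite <- (rev_involutive (map f s)), H, rev_app_distr. simpl.
    now rewrite <- !app_assoc. }
  apply map_eq_app in E. destruct E as (s1 & s2 & -> & E1 & E2).
  destruct s2 as [|x [|y [|z s2]]]; try discriminate E2.
  injection E2 as <- <- <- _. exists z, y, x. repeat split. now exists s1, s2.
Qed.

Lemma adj_snoc s c a u v :
  adj (s ++ [c; a]) u v -> adj (s ++ [c]) u v \/ (u = c /\ v = a).
Proof.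
  intros (x & y & H). destruct (@exists_last _ (u :: v :: y)) as (y' & z & E); [easy|].
  destruct y as [|w y].
  - right. change (s ++ [c; a]) with (s ++ [c] ++ [a]) in H.
    change (x ++ [u; v]) with (x ++ [u] ++ [v]) in H.
    rewrite !app_assoc in H. apply app_inj_tail in H as [H ->].
    now apply app_inj_tail in H as [_ ->].
  - left. destruct (@exists_last _ (w :: y)) as (y2 & z2 & E2); [easy|].
    exists x, y2. rewrite E2 in H.
    change (s ++ [c; a]) with (s ++ [c] ++ [a]) in H.
    change (x ++ u :: v :: y2 ++ [z2]) with (x ++ (u :: v :: y2) ++ [z2]) in H.
    rewrite !app_assoc in H. now apply app_inj_tail in H as [H _].
Qed.

Lemma cup_chain_app_l s t : cup_chain (s ++ t) -> cup_chain s.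
Proof.
  intros [H1 H2]. split; intros.
  - apply H1. now apply adj_app_l.
  - apply H2. now apply adj3_app_l.
Qed.

Lemma cup_chain_app_r s t : cup_chain (s ++ t) -> cup_chain t.
Proof.
  intros [H1 H2]. split; intros.
  - apply H1. now apply adj_app_r.
  - apply H2. now apply adj3_app_r.
Qed.

Lemma descending_app_l s t : descending (s ++ t) -> descending s.
Proof. intros H a b h. apply H. now apply adj_app_l. Qed.

Lemma descending_app_r s t : descending (s ++ t) -> descending t.
Proof. intros H a b h. apply H. now apply adj_app_r. Qed.

Lemma descending_single a : descending [a].
Proof. intros x y h. now apply adj_single in h. Qed.

(* Slopes increase along a cup, so a negative last slope makes all of them negative. *)
Lemma cup_chain_descending s c a :
  cup_chain (s ++ [c; a]) -> snd a < snd c -> descending (s ++ [c; a]).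
Proof.
  revert c a. induction s as [|d s IH] using rev_ind; intros c a H h.
  - intros u v huv. apply (adj_snoc []) in huv as [huv|[-> ->]]; [|easy].
    now apply adj_single in huv.
  - rewrite <- app_assoc in *. simpl in *.
    assert (Hd : snd c < snd d).
    { destruct H as [H1 H2].
      assert (fst d < fst c) by (apply H1; exists s, [a]; reflexivity).
      assert (fst c < fst a)
        by (apply H1; exists (s ++ [d]), []; now rewrite <- app_assoc).
      assert (0 < orient d c a) by (apply H2; exists s, []; reflexivity).
      unfold orient in *. nra. }
    intros u v huv.
    change (s ++ [d; c; a]) with (s ++ [d] ++ [c; a]) in *.
    rewrite app_assoc in huv.
    apply adj_snoc in huv as [huv|[-> ->]]; [|easy].
    rewrite <- app_assoc in huv. apply (IH d c); auto.
    apply (cup_chain_app_l _ [a]). now rewrite <- app_assoc.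
Qed.

Lemma descending_last s a : descending (s ++ [a]) -> forall p, In p s -> snd a < snd p.
Proof.
  induction s as [|b s IH]; intros H p Hp; [easy|].
  assert (Hd : descending (s ++ [a])) by (now apply (descending_app_r [b])).
  destruct Hp as [<-|Hp]; [|now apply IH].
  destruct s as [|c s].
  - apply H. exists [], []. reflexivity.
  - apply Rlt_trans with (snd c); [apply IH; simpl; auto|].
    apply H. exists [], (s ++ [a]). reflexivity.
Qed.

(** A discrete intermediate value argument. It supplies the edge of a chain that faces a point of
    the other half at height [y]. *)
Lemma descending_crossing s y :
  s <> [] -> (forall p, In p s -> snd p <> y) ->
  snd (last s pt0) < y < snd (hd pt0 s) ->
  exists a b, adj s a b /\ snd b < y < snd a.
Proof.
  induction s as [|a s IH]; intros h0 hne hy; [easy|].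
  destruct s as [|b s]; [simpl in hy; lra|].
  destruct (Rlt_dec y (snd b)) as [h|h].
  - destruct IH as (u & v & huv & hh); [easy|intros; apply hne; now right|simpl in *; lra|].
    exists u, v. split; [now apply (adj_app_r [a])|easy].
  - exists a, b. split; [now exists [], s|].
    specialize (hne b (or_intror (or_introl eq_refl))). simpl in hy. lra.
Qed.

Lemma increasing_split (A B : point -> Prop) s :
  (forall a b, A a -> B b -> fst a < fst b) ->
  (forall a b, adj s a b -> fst a < fst b) -> (forall p, In p s -> A p \/ B p) ->
  exists s1 s2, s = s1 ++ s2 /\ (forall p, In p s1 -> A p) /\ (forall p, In p s2 -> B p).
Proof.
  intros hAB. induction s as [|a s IH]; intros hs hin.
  - exists [], []. repeat split; intros p [].
  - destruct IH as (s1 & s2 & E & h1 & h2).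
    { intros; apply hs. now apply (adj_app_r [a]). }
    { intros; apply hin; now right. }
    subst s. destruct (hin a (or_introl eq_refl)) as [ha|ha].
    + exists (a :: s1), s2. repeat split; auto.
      intros p [<-|hp]; auto.
    + exists [], (a :: s1 ++ s2). repeat split; [intros p []|].
      intros p [<-|hp]; auto. destruct s1 as [|b s1]; [now apply h2|].
      assert (fst a < fst b) by (apply hs; now exists [], (s1 ++ s2)).
      assert (fst b < fst a) by (apply hAB; simpl in *; auto). lra.
Qed.

(** * Affine maps and reflections *)

Definition aff (alpha c beta d : R) (p : point) : point :=
  (alpha * fst p + c, beta * snd p + d).

Lemma orient_aff al c be d p q r :
  orient (aff al c be d p) (aff al c be d q) (aff al c be d r) = al * be * orient p q r.
Proof. unfold orient, aff; simpl. ring. Qed.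

Lemma orient_rot p q r : orient q r p = orient p q r.
Proof. unfold orient. ring. Qed.

Lemma orient_swap p q r : orient p r q = - orient p q r.
Proof. unfold orient. ring. Qed.

Lemma aff_inj al c be d p q : al <> 0 -> be <> 0 -> aff al c be d p = aff al c be d q -> p = q.
Proof.
  intros h1 h2. destruct p, q. unfold aff; simpl. intros H. injection H as H1 H2.
  f_equal; [apply (Rmult_eq_reg_l al)|apply (Rmult_eq_reg_l be)]; auto; lra.
Qed.

(** Both reflections reverse orientation. [mirror] also reverses the order of abscissas, so the
    reflected cup read backwards is again a cup; [flip] keeps that order and exchanges cups with
    caps. *)
Definition mirror : point -> point := aff (-1) 0 1 0.
Definition flip : point -> point := aff 1 0 (-1) 0.

Lemma mirrorK p : mirror (mirror p) = p.
Proof. destruct p. unfold mirror, aff; simpl. f_equal; ring. Qed.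

Lemma flipK p : flip (flip p) = p.
Proof. destruct p. unfold flip, aff; simpl. f_equal; ring. Qed.

Lemma map_mirrorK l : map mirror (map mirror l) = l.
Proof. rewrite map_map. rewrite <- (map_id l) at 2. apply map_ext, mirrorK. Qed.

Lemma map_flipK l : map flip (map flip l) = l.
Proof. rewrite map_map. rewrite <- (map_id l) at 2. apply map_ext, flipK. Qed.

Lemma orient_mirror p q r : orient (mirror p) (mirror q) (mirror r) = - orient p q r.
Proof. unfold mirror. rewrite orient_aff. ring. Qed.

Lemma orient_flip p q r : orient (flip p) (flip q) (flip r) = - orient p q r.
Proof. unfold flip. rewrite orient_aff. ring. Qed.

Lemma fst_mirror p : fst (mirror p) = - fst p.
Proof. unfold mirror, aff; simpl; ring. Qed.
Lemma snd_mirror p : snd (mirror p) = snd p.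
Proof. unfold mirror, aff; simpl; ring. Qed.
Lemma fst_flip p : fst (flip p) = fst p.
Proof. unfold flip, aff; simpl; ring. Qed.
Lemma snd_flip p : snd (flip p) = - snd p.
Proof. unfold flip, aff; simpl; ring. Qed.

Lemma cup_chain_mirror s : cup_chain s -> cup_chain (rev (map mirror s)).
Proof.
  intros [H1 H2]. split.
  - intros a b h. apply adj_rev_map in h as (a' & b' & -> & -> & h).
    rewrite !fst_mirror. apply H1 in h. lra.
  - intros a b c h. apply adj3_rev_map in h as (a' & b' & c' & -> & -> & -> & h).
    rewrite orient_mirror. apply H2 in h. rewrite orient_swap, orient_rot, orient_rot in h.
    unfold orient in *. nra.
Qed.

Lemma cup_chain_aff al c be d s :
  0 < al -> 0 < be -> cup_chain (map (aff al c be d) s) -> cup_chain s.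
Proof.
  intros ha hb [H1 H2]. split.
  - intros p q (u & v & ->). specialize (H1 (aff al c be d p) (aff al c be d q)).
    assert (h : fst (aff al c be d p) < fst (aff al c be d q)).
    { apply H1. exists (map (aff al c be d) u), (map (aff al c be d) v). now rewrite map_app. }
    unfold aff in h; simpl in h. nra.
  - intros p q r (u & v & ->).
    specialize (H2 (aff al c be d p) (aff al c be d q) (aff al c be d r)).
    rewrite orient_aff in H2.
    assert (h : 0 < al * be * orient p q r).
    { apply H2. exists (map (aff al c be d) u), (map (aff al c be d) v). now rewrite map_app. }
    assert (0 < al * be) by nra. nra.
Qed.

(** * Separated pairs *)

(* The lines spanned by each of the two sets are so steep, compared with those joining
   the sets, that they have all of the other set on one side. *)
Definition wellsep (A B : point -> Prop) : Prop :=
  (forall a b, A a -> B b -> fst a < fst b) /\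
  (forall a a' b, A a -> A a' -> B b -> snd a' < snd a -> 0 < orient a a' b) /\
  (forall a b b', A a -> B b -> B b' -> snd b < snd b' -> 0 < orient a b b').

Definition image (f : point -> point) (A : point -> Prop) (q : point) : Prop :=
  exists p, A p /\ q = f p.

Lemma wellsep_ext (A A' B B' : point -> Prop) :
  (forall p, A' p -> A p) -> (forall p, B' p -> B p) -> wellsep A B -> wellsep A' B'.
Proof. intros hA hB (h1 & h2 & h3). repeat split; intros; auto. Qed.

Lemma wellsep_mirror A B : wellsep A B -> wellsep (image mirror B) (image mirror A).
Proof.
  intros (h1 & h2 & h3). split; [|split].
  - intros b a (b' & hb & ->) (a' & ha & ->). rewrite !fst_mirror.
    specialize (h1 a' b' ha hb). lra.
  - intros b1 b2 a (b1' & hb1 & ->) (b2' & hb2 & ->) (a' & ha & ->).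
    rewrite !snd_mirror, orient_mirror. intros h.
    specialize (h3 a' b2' b1' ha hb2 hb1 h). unfold orient in *; nra.
  - intros b a1 a2 (b' & hb & ->) (a1' & ha1 & ->) (a2' & ha2 & ->).
    rewrite !snd_mirror, orient_mirror. intros h.
    specialize (h2 a2' a1' b' ha2 ha1 hb h). unfold orient in *; nra.
Qed.

Lemma wellsep_flip A B : wellsep A B -> wellsep (image flip A) (image flip B).
Proof.
  intros (h1 & h2 & h3). split; [|split].
  - intros a b (a' & ha & ->) (b' & hb & ->). rewrite !fst_flip. auto.
  - intros a1 a2 b (a1' & ha1 & ->) (a2' & ha2 & ->) (b' & hb & ->).
    rewrite !snd_flip, orient_flip. intros h.
    assert (h' : snd a1' < snd a2') by lra.
    specialize (h2 a2' a1' b' ha2 ha1 hb h'). unfold orient in *; nra.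
  - intros a b1 b2 (a' & ha & ->) (b1' & hb1 & ->) (b2' & hb2 & ->).
    rewrite !snd_flip, orient_flip. intros h.
    assert (h' : snd b2' < snd b1') by lra.
    specialize (h3 a' b2' b1' ha hb2 hb1 h'). unfold orient in *; nra.
Qed.

Lemma wellsep_aff al c be d A B :
  0 < al -> 0 < be -> wellsep A B -> wellsep (image (aff al c be d) A) (image (aff al c be d) B).
Proof.
  intros hal hbe (h1 & h2 & h3).
  assert (hab : 0 < al * be) by nra. split; [|split].
  - intros a b (a' & ha & ->) (b' & hb & ->). specialize (h1 a' b' ha hb).
    unfold aff; simpl; nra.
  - intros a1 a2 b (a1' & ha1 & ->) (a2' & ha2 & ->) (b' & hb & ->) h.
    rewrite orient_aff. apply Rmult_lt_0_compat; auto. apply h2; auto.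
    unfold aff in h; simpl in h; nra.
  - intros a b1 b2 (a' & ha & ->) (b1' & hb1 & ->) (b2' & hb2 & ->) h.
    rewrite orient_aff. apply Rmult_lt_0_compat; auto. apply h3; auto.
    unfold aff in h; simpl in h; nra.
Qed.

Definition yinj (A : point -> Prop) : Prop :=
  forall p q, A p -> A q -> snd p = snd q -> p = q.

(** If the last step inside [A] went up, separation would put [b] to the right of that step, whereas
    a cup turns left. So the last slope inside [A] is negative, and convexity makes the earlier ones
    negative too. *)
Lemma wellsep_prefix_descending A B s b :
  wellsep A B -> yinj A -> cup_chain (s ++ [b]) -> (forall p, In p s -> A p) -> B b ->
  descending s.
Proof.
  intros (h1 & h2 & h3) hy hc hA hb.
  destruct s as [|a s _] using rev_ind; [intros u v h; now apply adj_nil in h|].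
  destruct s as [|c s _] using rev_ind; [apply descending_single|].
  rewrite <- !app_assoc in *. simpl in *.
  assert (Ha : A a) by (apply hA, in_or_app; simpl; auto).
  assert (Hc : A c) by (apply hA, in_or_app; simpl; auto).
  apply cup_chain_descending.
  - apply (cup_chain_app_l _ [b]). now rewrite <- app_assoc.
  - assert (ho : 0 < orient c a b) by (apply hc; exists s, []; reflexivity).
    assert (hx : fst c < fst a) by (apply hc; exists s, [b]; reflexivity).
    destruct (Rtotal_order (snd a) (snd c)) as [h|[h|h]]; auto.
    + apply hy in h; auto. subst. lra.
    + specialize (h2 a c b Ha Hc hb h). unfold orient in *; nra.
Qed.

(** Ascent is phrased as descent of the reversed reflection, so that counting on descending chains
    covers both sides of a cup. *)
Lemma wellsep_suffix_ascending A B s a :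
  wellsep A B -> yinj B -> cup_chain (a :: s) -> A a -> (forall p, In p s -> B p) ->
  descending (rev (map mirror s)).
Proof.
  intros hw hy hc ha hB.
  apply (wellsep_prefix_descending _ _ _ (mirror a) (wellsep_mirror _ _ hw)).
  - intros p q (p' & hp & ->) (q' & hq & ->). rewrite !snd_mirror. intros E.
    f_equal. now apply hy.
  - exact (cup_chain_mirror _ hc).
  - intros p hp. apply in_rev in hp. apply in_map_iff in hp as (p' & <- & hp).
    exists p'. auto.
  - exists a. auto.
Qed.

Lemma descending_rev_mirror s a b :
  descending (rev (map mirror s)) -> adj s a b -> snd a < snd b.
Proof.
  intros h (u & v & ->). rewrite <- (snd_mirror a), <- (snd_mirror b). apply h.
  exists (rev (map mirror v)), (rev (map mirror u)).
  rewrite map_app, rev_app_distr. simpl. now rewrite <- !app_assoc.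
Qed.

(** * Rotated Horton sets *)

Definition pts (F : Z -> list point) (lo hi : Z) (p : point) : Prop :=
  exists i, (lo <= i <= hi)%Z /\ In p (F i).

(* A Horton set turned by a quarter: the cells [F i] are stacked vertically in the order
   of [i], the cells of one parity form the left half and the others the right half. *)
Inductive horton (Q : list point -> Prop) : Z -> Z -> (Z -> list point) -> Prop :=
| horton_leaf i F : Q (F i) -> horton Q i i F
| horton_node lo hi o o' FA FB F :
    horton Q lo hi FA -> horton Q lo hi FB ->
    (o' = o + 1 \/ o = o' + 1)%Z ->
    (forall i, F (2 * i + o)%Z = FA i) -> (forall i, F (2 * i + o')%Z = FB i) ->
    wellsep (pts FA lo hi) (pts FB lo hi) ->
    horton Q (2 * lo + Z.min o o') (2 * hi + Z.max o o') F.

(** Kept apart from [horton] because it passes from the whole set to both halves, so one check at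
    the top suffices. *)
Definition stacked (F : Z -> list point) (lo hi : Z) : Prop :=
  forall i j p q, (lo <= i)%Z -> (i < j)%Z -> (j <= hi)%Z ->
    In p (F i) -> In q (F j) -> snd p < snd q.

Lemma pts_parity lo hi o o' FA FB F p :
  (o' = o + 1 \/ o = o' + 1)%Z ->
  (forall i, F (2 * i + o)%Z = FA i) -> (forall i, F (2 * i + o')%Z = FB i) ->
  pts F (2 * lo + Z.min o o') (2 * hi + Z.max o o') p -> pts FA lo hi p \/ pts FB lo hi p.
Proof.
  intros ho hA hB (i & hi' & hp).
  destruct (Z.Even_or_Odd (i - o)) as [[t ht]|[t ht]].
  - left. exists t. split; [lia|]. now rewrite <- hA, <- ht, Z.sub_add.
  - right. destruct ho as [->| ->].
    + exists t. split; [lia|]. rewrite <- hB.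
      now replace (2 * t + (o + 1))%Z with i by lia.
    + exists (t + 1)%Z. split; [lia|]. rewrite <- hB.
      now replace (2 * (t + 1) + o')%Z with i by lia.
Qed.

Lemma stacked_half lo hi o o' FA F :
  (forall i, F (2 * i + o)%Z = FA i) ->
  stacked F (2 * lo + Z.min o o') (2 * hi + Z.max o o') -> stacked FA lo hi.
Proof.
  intros hA h i j p q h1 h2 h3. rewrite <- !hA. apply h; lia.
Qed.

Lemma stacked_half' lo hi o o' FB F :
  (forall i, F (2 * i + o')%Z = FB i) ->
  stacked F (2 * lo + Z.min o o') (2 * hi + Z.max o o') -> stacked FB lo hi.
Proof.
  intros hA h i j p q h1 h2 h3. rewrite <- !hA. apply h; lia.
Qed.

(** Reflection exchanges the two halves together with their offsets; this is why a node lets either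
    parity be on the left. *)
Lemma horton_mirror Q lo hi F :
  horton Q lo hi F -> horton (fun l => Q (map mirror l)) lo hi (fun i => map mirror (F i)).
Proof.
  induction 1 as [i F h|lo hi o o' FA FB F HA IHA HB IHB ho hA hB hw].
  - constructor. now rewrite map_mirrorK.
  - rewrite (Z.min_comm o), (Z.max_comm o).
    apply horton_node with (1 := IHB) (2 := IHA); try (intros; congruence); [lia|].
    apply wellsep_mirror in hw. revert hw. apply wellsep_ext.
    + intros p (i & hi' & hp). apply in_map_iff in hp as (q & <- & hq).
      exists q; split; auto. now exists i.
    + intros p (i & hi' & hp). apply in_map_iff in hp as (q & <- & hq).
      exists q; split; auto. now exists i.
Qed.

(** Turning the stack upside down negates the indices, which is the reason for indexing cells by
    integers and for arbitrary offsets. *)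
Lemma horton_flip Q lo hi F :
  horton Q lo hi F ->
  horton (fun l => Q (map flip l)) (- hi) (- lo) (fun i => map flip (F (- i)%Z)).
Proof.
  induction 1 as [i F h|lo hi o o' FA FB F HA IHA HB IHB ho hA hB hw].
  - constructor. now rewrite map_flipK, Z.opp_involutive.
  - replace (- (2 * hi + Z.max o o'))%Z with (2 * - hi + Z.min (- o) (- o'))%Z by lia.
    replace (- (2 * lo + Z.min o o'))%Z with (2 * - lo + Z.max (- o) (- o'))%Z by lia.
    apply horton_node with (1 := IHA) (2 := IHB).
    + lia.
    + intros i. rewrite <- hA. do 2 f_equal. lia.
    + intros i. rewrite <- hB. do 2 f_equal. lia.
    + apply wellsep_flip in hw. revert hw. apply wellsep_ext.
      * intros p (i & hi' & hp). apply in_map_iff in hp as (q & <- & hq).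
        exists q; split; auto. exists (- i)%Z; split; auto; lia.
      * intros p (i & hi' & hp). apply in_map_iff in hp as (q & <- & hq).
        exists q; split; auto. exists (- i)%Z; split; auto; lia.
Qed.

Lemma horton_aff (Q Q' : list point -> Prop) al c be d lo hi F :
  0 < al -> 0 < be -> (forall l, Q l -> Q' (map (aff al c be d) l)) ->
  horton Q lo hi F -> horton Q' lo hi (fun i => map (aff al c be d) (F i)).
Proof.
  intros hal hbe hQ. induction 1 as [i F h|lo hi o o' FA FB F HA IHA HB IHB ho hA hB hw].
  - constructor. auto.
  - apply horton_node with (1 := IHA) (2 := IHB); try (intros; congruence); auto.
    apply (wellsep_aff al c be d) in hw; auto. revert hw. apply wellsep_ext.
    + intros p (i & hi' & hp). apply in_map_iff in hp as (q & <- & hq).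
      exists q; split; auto. now exists i.
    + intros p (i & hi' & hp). apply in_map_iff in hp as (q & <- & hq).
      exists q; split; auto. now exists i.
Qed.

Lemma horton_cell Q lo hi F i : horton Q lo hi F -> (lo <= i <= hi)%Z -> Q (F i).
Proof.
  intros H. revert i. induction H as [j F h|lo hi o o' FA FB F HA IHA HB IHB ho hA hB hw];
    intros i hi'.
  - now replace i with j by lia.
  - destruct (Z.Even_or_Odd (i - o)) as [[t ht]|[t ht]].
    + replace i with (2 * t + o)%Z by lia. rewrite hA. apply IHA. lia.
    + destruct ho as [->| ->].
      * replace i with (2 * t + (o + 1))%Z by lia. rewrite hB. apply IHB; lia.
      * replace i with (2 * (t + 1) + o')%Z by lia. rewrite hB. apply IHB; lia.
Qed.

Lemma horton_yinj Q lo hi F :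
  (forall l, Q l -> yinj (fun p => In p l)) -> horton Q lo hi F -> stacked F lo hi ->
  yinj (pts F lo hi).
Proof.
  intros hQ HT hs p q (i & hi' & hp) (j & hj & hq) h.
  destruct (Z.lt_total i j) as [hij|[->|hij]].
  - assert (snd p < snd q) by (apply (hs i j); auto; lia). lra.
  - apply (hQ (F j)); auto. now apply (horton_cell Q lo hi).
  - assert (snd q < snd p) by (apply (hs j i); auto; lia). lra.
Qed.

(** * Points inside a descending cup *)

(** Edges of a descending chain point downwards, so positive orientation places [q] on their right,
    the inner side of the cup. With [q] between the endpoints in height, any apex in the right half
    completes a triangle around [q]. *)
Definition east (s : list point) (q : point) : Prop :=
  exists a b, adj s a b /\ snd b < snd q < snd a /\ 0 < orient a b q.

Lemma east_app s t q : east s q -> east (s ++ t) q.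
Proof. intros (a & b & h & h'). exists a, b. split; auto. now apply adj_app_l. Qed.

Lemma pow2_pos n : (1 <= 2 ^ n)%nat.
Proof. pose proof (Nat.pow_nonzero 2 n). lia. Qed.

(** With k = length s - e - 1, the invariant is a pair: the index gap i - j is at least 2^k - 1, and
    the cells inside number at least 2^k - (k + 1). When one more point is taken in the right half,
    the left gap contributes as many new cells, and doubling the indices doubles it. Here [e] is the
    surplus over one point allowed in a single cell. *)
Lemma descending_cup_count (Q : list point -> Prop) (e : nat) lo hi F :
  (forall l, Q l -> yinj (fun p => In p l)) ->
  (forall l s, Q l -> (forall p, In p s -> In p l) -> cup_chain s -> descending s ->
     (length s <= e + 1)%nat) ->
  horton Q lo hi F -> stacked F lo hi ->
  forall s, (forall p, In p s -> pts F lo hi p) -> cup_chain s -> descending s ->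
    (e + 1 <= length s)%nat ->
    exists i j cells,
      (lo <= j <= hi)%Z /\ (lo <= i <= hi)%Z /\
      In (hd pt0 s) (F i) /\ In (last s pt0) (F j) /\
      NoDup cells /\
      (forall t, In t cells -> (lo <= t <= hi)%Z /\ forall q, In q (F t) -> east s q) /\
      (2 ^ (length s - e - 1) <= length cells + (length s - e))%nat /\
      (Z.of_nat (2 ^ (length s - e - 1)) - 1 <= i - j)%Z.
Proof.
  intros hy hQ. induction 1 as [i F h|lo hi o o' FA FB F HA IHA HB IHB ho hA hB hw];
    intros hs s hin hc hde hlen.
  - assert (hin' : forall p, In p s -> In p (F i)).
    { intros p hp. destruct (hin p hp) as (t & ht & h'). now replace i with t by lia. }
    assert (hl : (length s <= e + 1)%nat) by (now apply (hQ (F i))).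
    assert (h0 : (length s - e - 1 = 0)%nat) by lia. rewrite h0.
    exists i, i, []. do 2 (split; [lia|]). split; [|split; [|split; [|split]]].
    + apply hin'. destruct s; simpl in *; [lia|auto].
    + apply hin'. destruct (@exists_last _ s) as (s' & z & ->).
      { intros ->; simpl in *; lia. }
      rewrite last_last. apply in_or_app; simpl; auto.
    + constructor.
    + intros t [].
    + simpl. lia.
  - assert (hsA := stacked_half _ _ _ _ _ _ hA hs).
    assert (hsB := stacked_half' _ _ _ _ _ _ hB hs).
    assert (hyB : yinj (pts FB lo hi)) by (eapply horton_yinj; eauto).
    destruct (increasing_split (pts FA lo hi) (pts FB lo hi) s) as (s1 & s2 & -> & h1 & h2).
    { apply hw. } { apply hc. }
    { intros p hp. eapply pts_parity; eauto. }
    destruct s2 as [|b s2].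
    { rewrite app_nil_r in *.
      destruct (IHA hsA s1) as (i & j & L & hj & hi' & e1 & e2 & e3 & e4 & e5 & e6); auto.
      exists (2 * i + o)%Z, (2 * j + o)%Z, (map (fun t => 2 * t + o)%Z L).
      rewrite !hA, length_map.
      do 2 (split; [lia|]). do 2 (split; [auto|]). split; [|split].
      - apply Injective_map_NoDup; auto. intros x y; lia.
      - intros t ht. apply in_map_iff in ht as (u & <- & hu). rewrite hA.
        apply e4 in hu. split; [lia|easy].
      (* The gap is nonnegative because the power is at least 1, so doubling the indices cannot
         reduce it. *)
      - pose proof (pow2_pos (length s1 - e - 1)). lia. }
    destruct s1 as [|a s1].
    { simpl app in *.
      destruct (IHB hsB (b :: s2)) as (i & j & L & hj & hi' & e1 & e2 & e3 & e4 & e5 & e6); auto.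
      exists (2 * i + o')%Z, (2 * j + o')%Z, (map (fun t => 2 * t + o')%Z L).
      rewrite !hB, length_map.
      do 2 (split; [lia|]). do 2 (split; [auto|]). split; [|split].
      - apply Injective_map_NoDup; auto. intros x y; lia.
      - intros t ht. apply in_map_iff in ht as (u & <- & hu). rewrite hB.
        apply e4 in hu. split; [lia|easy].
      - pose proof (pow2_pos (length (b :: s2) - e - 1)). lia. }
    assert (hb : pts FB lo hi b) by (apply h2; simpl; auto).
    (* two points on the right would force the last slope to be positive *)
    assert (s2 = []) as ->.
    { destruct s2 as [|b' s2]; auto. exfalso.
      destruct (@exists_last _ (a :: s1)) as (t & z & E); [easy|]. rewrite E in *.
      assert (hz : pts FA lo hi z) by (apply h1, in_or_app; simpl; auto).
      assert (hb' : pts FB lo hi b') by (apply h2; simpl; auto).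
      assert (0 < orient z b b').
      { apply hc. exists t, s2. now rewrite <- app_assoc. }
      assert (snd b' < snd b).
      { apply hde. exists (t ++ [z]), s2. now rewrite <- !app_assoc. }
      assert (0 < orient z b' b) by (now apply hw).
      unfold orient in *; nra. }
    rewrite length_app in *. cbn [length] in *.
    remember (a :: s1) as s eqn:Es. clear h2.
    assert (hne : s <> []) by (subst; easy).
    assert (hl1 : (1 <= length s)%nat) by (subst; simpl; lia).
    replace (S (length s1)) with (length s) in * by (subst; reflexivity).
    assert (hlast : last (s ++ [b]) pt0 = b) by apply last_last.
    assert (hhd : hd pt0 (s ++ [b]) = hd pt0 s) by (subst; reflexivity).
    destruct hb as (jb & hjb & hb).
    destruct (le_lt_dec (e + 1) (length s)) as [hle|hlt].
    + destruct (IHA hsA s) as (i & j & L & hj & hi' & e1 & e2 & e3 & e4 & e5 & e6); auto.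
      { now apply cup_chain_app_l in hc. }
      { now apply descending_app_l in hde. }
      (* The new last point lies below the old one, hence in a lower cell. This adds 1 to the
         doubled gap: 2 (2^k - 1) + 1 = 2^(k+1) - 1. *)
      assert (hbj : (2 * jb + o' < 2 * j + o)%Z).
      { destruct (Z_lt_le_dec (2 * jb + o') (2 * j + o)) as [h|h]; auto. exfalso.
        assert (hlt : snd b < snd (last s pt0)).
        { apply (descending_last s); auto.
          destruct (@exists_last _ s) as (s' & z & ->); auto.
          rewrite last_last. apply in_or_app; simpl; auto. }
        assert (snd (last s pt0) < snd b).
        { apply (hs (2 * j + o)%Z (2 * jb + o')%Z); try lia.
          - now rewrite hA. - now rewrite hB. }
        lra. }
      (* [t0] indexes the lowest right-half cell above cell 2j + o. From there exactly i - j
         consecutive right-half cells fit below cell 2i + o, for either parity; they form [M]. *)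
      pose (t0 := if Z.eq_dec o' (o + 1) then j else (j + 1)%Z).
      assert (ht0 : (o' = o + 1 /\ t0 = j \/ o = o' + 1 /\ t0 = j + 1)%Z).
      { unfold t0. destruct (Z.eq_dec o' (o + 1)); lia. }
      pose (M := map (fun k => 2 * (t0 + Z.of_nat k) + o')%Z (seq 0 (Z.to_nat (i - j)))).
      exists (2 * i + o)%Z, (2 * jb + o')%Z, (map (fun t => 2 * t + o)%Z L ++ M).
      rewrite hlast, hhd, hA, hB.
      split; [lia|]. split; [lia|]. split; [auto|]. split; [auto|].
      split; [|split; [|split]].
      * apply NoDup_app.
        -- apply Injective_map_NoDup; auto. intros x y; lia.
        -- apply Injective_map_NoDup; [intros x y; lia|apply seq_NoDup].
        -- intros x hx hx'. apply in_map_iff in hx as (u & <- & hu).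
           apply in_map_iff in hx' as (v & hv & _). lia.
      * intros t ht. apply in_app_or in ht as [ht|ht].
        -- apply in_map_iff in ht as (u & <- & hu). specialize (e4 _ hu) as [e4 e4'].
           split; [lia|]. intros q hq. rewrite hA in hq. apply east_app. auto.
        -- apply in_map_iff in ht as (k & <- & hk). apply in_seq in hk.
           split; [lia|]. intros q hq.
           assert (hq1 : snd (last s pt0) < snd q).
           { apply (hs (2 * j + o)%Z (2 * (t0 + Z.of_nat k) + o')%Z); auto; try lia.
             now rewrite hA. }
           assert (hq2 : snd q < snd (hd pt0 s)).
           { apply (hs (2 * (t0 + Z.of_nat k) + o')%Z (2 * i + o)%Z); auto; try lia.
             now rewrite hA. }
           (* Cells of different parity never share a height, so [q] is strictly between the ends of
              some edge of [s], and separation puts all of the right half to the east of that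
              edge. *)
           destruct (descending_crossing s (snd q)) as (u & v & huv & hh); auto.
           { intros p hp E. destruct (h1 p hp) as (ip & hip & hp').
             rewrite <- hA in hp'.
             destruct (Z.lt_total (2 * ip + o) (2 * (t0 + Z.of_nat k) + o')) as [h|[h|h]].
             - assert (snd p < snd q) by (eapply hs; [| exact h | | |]; eauto; lia). lra.
             - lia.
             - assert (snd q < snd p) by (eapply hs; [| exact h | | |]; eauto; lia). lra. }
           apply east_app. exists u, v. split; [auto|]. split; [auto|].
           destruct (adj_in _ _ _ huv) as [hu hv].
           destruct hh as [hh1 hh2], hw as (_ & hw2 & _). apply (hw2 u v q); auto;
             [|now apply Rlt_trans with (snd q)].
           exists (t0 + Z.of_nat k)%Z. split; [lia|].
           now rewrite <- hB.
      * rewrite length_app. unfold M. rewrite !length_map, length_seq.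
        replace (length s + 1 - e - 1)%nat with (S (length s - e - 1)) by lia.
        rewrite Nat.pow_succ_r'. lia.
      * replace (length s + 1 - e - 1)%nat with (S (length s - e - 1)) by lia.
        rewrite Nat.pow_succ_r', Nat2Z.inj_mul. lia.
    (* Here [s] has exactly [e] points: with exponent 0 no cell is promised, and only a nonnegative
       gap remains to be shown. *)
    + assert (h0 : (length s + 1 - e - 1 = 0)%nat) by lia. rewrite h0, hlast, hhd.
      destruct (h1 (hd pt0 s)) as (i & hi' & hp); [subst; simpl; auto|].
      assert (hbj : (2 * jb + o' < 2 * i + o)%Z).
      { destruct (Z_lt_le_dec (2 * jb + o') (2 * i + o)) as [h|h]; auto. exfalso.
        assert (hlt' : snd b < snd (hd pt0 s)).
        { apply (descending_last s); auto. subst; simpl; auto. }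
        assert (hlt2 : snd (hd pt0 s) < snd b).
        { apply (hs (2 * i + o)%Z (2 * jb + o')%Z); try lia.
          - now rewrite hA. - now rewrite hB. }
        lra. }
      exists (2 * i + o)%Z, (2 * jb + o')%Z, [].
      rewrite hA, hB. do 2 (split; [lia|]). do 2 (split; [auto|]).
      split; [constructor|]. split; [intros t []|].
      change (2 ^ 0)%nat with 1%nat. cbn [length]. lia.
Qed.

(** * Points inside an arbitrary cup *)

Definition in_triangle (s : list point) (q : point) : Prop :=
  exists u v w, In u s /\ In v s /\ In w s /\
    0 < orient u v q /\ 0 < orient v w q /\ 0 < orient w u q.

Lemma in_triangle_flip s q : in_triangle (map flip s) (flip q) -> in_triangle s q.
Proof.
  intros (u & v & w & hu & hv & hw & h1 & h2 & h3).
  apply in_map_iff in hu as (u' & <- & hu), hv as (v' & <- & hv), hw as (w' & <- & hw).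
  rewrite !orient_flip in *.
  exists v', u', w'. repeat split; auto; unfold orient in *; nra.
Qed.

(** [e1] and [e2] are the surplus over one point that a cell may give to a descending and to an
    ascending chain; the last clause excludes long cups inside a single cell. *)
Definition cup_bounded (e1 e2 : nat) (l : list point) : Prop :=
  yinj (fun p => In p l) /\
  (forall s, (forall p, In p s -> In p l) -> cup_chain s -> descending s ->
     (length s <= e1 + 1)%nat) /\
  (forall s, (forall p, In p s -> In p l) -> cup_chain s -> descending (rev (map mirror s)) ->
     (length s <= e2 + 1)%nat) /\
  (forall s, (forall p, In p s -> In p l) -> cup_chain s -> (length s <= e1 + e2 + 1)%nat).

Lemma pts_mirror F lo hi p :
  pts F lo hi p -> pts (fun i => map mirror (F i)) lo hi (mirror p).
Proof. intros (i & h & hp). exists i. split; auto. now apply in_map. Qed.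

Lemma adj_mirror_back s a b : adj (rev (map mirror s)) a b -> adj s (mirror b) (mirror a).
Proof.
  intros h. apply adj_rev_map in h as (a' & b' & -> & -> & h). now rewrite !mirrorK.
Qed.

(** The cup has too many points for one cell, so some node has both halves met by it. There the left
    part descends, the right part ascends, and each is counted separately; a point of the opposite
    half is the apex of all triangles over its edges. [p] and [q] are the sizes of the parts after
    removal of the surplus, but at least 1. *)
Lemma cup_count (Q : list point -> Prop) e1 e2 lo hi F :
  (forall l, Q l -> cup_bounded e1 e2 l) -> horton Q lo hi F -> stacked F lo hi ->
  forall s r, (forall p, In p s -> pts F lo hi p) -> cup_chain s ->
    (length s = e1 + e2 + r)%nat -> (2 <= r)%nat ->
    exists cells p q,
      NoDup cells /\
      (forall t, In t cells ->
         (lo <= t <= hi)%Z /\ forall x, In x (F t) -> in_triangle s x) /\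
      (1 <= p)%nat /\ (1 <= q)%nat /\ (r <= p + q)%nat /\
      (2 ^ (p - 1) + 2 ^ (q - 1) <= length cells + p + q)%nat.
Proof.
  intros hQ. induction 1 as [i F h|lo hi o o' FA FB F HA IHA HB IHB ho hA hB hw];
    intros hs s r hin hc hlen hr.
  - exfalso. destruct (hQ _ h) as (_ & _ & _ & hb).
    assert (length s <= e1 + e2 + 1)%nat; [|lia]. apply hb; auto.
    intros p hp. destruct (hin p hp) as (t & ht & h'). now replace i with t by lia.
  - assert (hsA := stacked_half _ _ _ _ _ _ hA hs).
    assert (hsB := stacked_half' _ _ _ _ _ _ hB hs).
    assert (hyA : yinj (pts FA lo hi)).
    { eapply horton_yinj; eauto. intros l hl. apply (hQ l hl). }
    assert (hyB : yinj (pts FB lo hi)).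
    { eapply horton_yinj; eauto. intros l hl. apply (hQ l hl). }
    destruct (increasing_split (pts FA lo hi) (pts FB lo hi) s) as (s1 & s2 & -> & h1 & h2).
    { apply hw. } { apply hc. }
    { intros p hp. eapply pts_parity; eauto. }
    destruct s2 as [|b s2].
    { rewrite app_nil_r in *.
      destruct (IHA hsA s1 r) as (L & p & q & g1 & g2 & g); auto.
      exists (map (fun t => 2 * t + o)%Z L), p, q. rewrite length_map.
      split; [|split; auto].
      - apply Injective_map_NoDup; auto. intros x y; lia.
      - intros t ht. apply in_map_iff in ht as (u & <- & hu). rewrite hA.
        apply g2 in hu. split; [lia|easy]. }
    destruct (rev s1) as [|a s1r] eqn:Es1.
    { assert (s1 = []) as -> by (rewrite <- (rev_involutive s1), Es1; reflexivity).
      simpl app in *.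
      destruct (IHB hsB (b :: s2) r) as (L & p & q & g1 & g2 & g); auto.
      exists (map (fun t => 2 * t + o')%Z L), p, q. rewrite length_map.
      split; [|split; auto].
      - apply Injective_map_NoDup; auto. intros x y; lia.
      - intros t ht. apply in_map_iff in ht as (u & <- & hu). rewrite hB.
        apply g2 in hu. split; [lia|easy]. }
    assert (Es : s1 = rev s1r ++ [a]).
    { rewrite <- (rev_involutive s1), Es1. reflexivity. }
    assert (ha1 : In a s1) by (rewrite Es; apply in_or_app; simpl; auto).
    assert (ha : pts FA lo hi a) by auto.
    assert (hb : pts FB lo hi b) by (apply h2; simpl; auto).
    assert (hd1 : descending s1).
    { apply (wellsep_prefix_descending _ _ s1 b hw hyA); auto.
      apply (cup_chain_app_l _ s2). now rewrite <- app_assoc. }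
    assert (hc2 : cup_chain (b :: s2)) by (now apply cup_chain_app_r in hc).
    assert (hc2' := cup_chain_mirror _ hc2).
    assert (hsM : stacked (fun i => map mirror (FB i)) lo hi).
    { intros i j p q u1 u2 u3 hp hq.
      apply in_map_iff in hp as (p' & <- & hp), hq as (q' & <- & hq).
      rewrite !snd_mirror. now apply (hsB i j). }
    assert (hinM : forall p, In p (rev (map mirror (b :: s2))) ->
              pts (fun i => map mirror (FB i)) lo hi p).
    { intros p hp. apply in_rev in hp. apply in_map_iff in hp as (p' & <- & hp).
      now apply pts_mirror, h2. }
    assert (hd2 : descending (rev (map mirror (b :: s2)))).
    { apply (wellsep_suffix_ascending _ _ _ a hw); auto.
      apply (cup_chain_app_r (rev s1r)). rewrite Es, <- app_assoc in hc. exact hc. }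
    assert (hA' : exists L p, (1 <= p)%nat /\ (length s1 <= p + e1)%nat /\ NoDup L /\
        (forall t, In t L -> (lo <= t <= hi)%Z /\ forall q, In q (FA t) -> east s1 q) /\
        (2 ^ (p - 1) <= length L + p)%nat).
    { destruct (le_lt_dec (e1 + 1) (length s1)) as [hle|hlt].
      - destruct (descending_cup_count Q e1 lo hi FA (fun l hl => proj1 (hQ l hl))
          (fun l t hl => proj1 (proj2 (hQ l hl)) t) HA hsA s1)
          as (i & j & L & _ & _ & _ & _ & g1 & g2 & g3 & _); auto.
        + now apply cup_chain_app_l in hc.
        + exists L, (length s1 - e1)%nat. split; [lia|]. split; [lia|]. auto.
      (* A part within its surplus is charged as a single point: 2^0 <= 0 + 1 with no cells. *)
      - exists [], 1%nat. split; [lia|]. split; [lia|]. split; [constructor|].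
        split; [intros t []|]. simpl; lia. }
    assert (hB' : exists L q, (1 <= q)%nat /\ (length (b :: s2) <= q + e2)%nat /\ NoDup L /\
        (forall t, In t L -> (lo <= t <= hi)%Z /\
           forall x, In x (FB t) -> east (rev (map mirror (b :: s2))) (mirror x)) /\
        (2 ^ (q - 1) <= length L + q)%nat).
    { destruct (le_lt_dec (e2 + 1) (length (b :: s2))) as [hle|hlt].
      (* The ascending part is counted in the reflected Horton set, whose cells satisfy the
         reflected predicate. *)
      - pose (QM := fun l => Q (map mirror l)).
        assert (hyM : forall l, QM l -> yinj (fun p => In p l)).
        { intros l hl p q hp hq E. destruct (hQ _ hl) as (y & _).
          rewrite <- (mirrorK p), <- (mirrorK q). f_equal.
          apply y; try now apply in_map. now rewrite !snd_mirror. }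
        assert (hQM : forall l t, QM l -> (forall p, In p t -> In p l) -> cup_chain t ->
                  descending t -> (length t <= e2 + 1)%nat).
        { intros l t hl ht hct hdt. destruct (hQ _ hl) as (_ & _ & y & _).
          specialize (y (rev (map mirror t))). rewrite length_rev, length_map in y.
          apply y.
          * intros p hp. apply in_rev in hp. apply in_map_iff in hp as (p' & <- & hp).
            apply in_map. auto.
          * now apply cup_chain_mirror.
          * now rewrite map_rev, rev_involutive, map_mirrorK. }
        destruct (descending_cup_count QM e2 lo hi _ hyM hQM (horton_mirror _ _ _ _ HB) hsM
          (rev (map mirror (b :: s2))))
          as (i & j & L & _ & _ & _ & _ & g1 & g2 & g3 & _); auto.
        + now rewrite length_rev, length_map.
        + rewrite length_rev, length_map in g3.
          exists L, (length (b :: s2) - e2)%nat. split; [lia|]. split; [lia|].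
          split; auto. split; auto. intros t ht. destruct (g2 t ht) as [u1 u2].
          split; auto. intros x hx. apply u2. now apply in_map.
      - exists [], 1%nat. split; [lia|]. split; [lia|]. split; [constructor|].
        split; [intros t []|]. simpl; lia. }
    destruct hA' as (LA & p & p1 & p2 & p3 & p4 & p5).
    destruct hB' as (LB & q & q1 & q2 & q3 & q4 & q5).
    destruct hw as (_ & hw2 & hw3).
    exists (map (fun t => 2 * t + o)%Z LA ++ map (fun t => 2 * t + o')%Z LB), p, q.
    rewrite length_app in hlen |- *. rewrite !length_map.
    split; [|split; [|repeat split; lia]].
    + apply NoDup_app.
      * apply Injective_map_NoDup; auto. intros x y; lia.
      * apply Injective_map_NoDup; auto. intros x y; lia.
      * intros x hx hx'. apply in_map_iff in hx as (u & <- & hu).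
        apply in_map_iff in hx' as (v & hv & _). lia.
    + intros t ht. apply in_app_or in ht as [ht|ht].
      * apply in_map_iff in ht as (u & <- & hu). destruct (p4 _ hu) as [g g'].
        split; [lia|]. intros x hx. rewrite hA in hx.
        assert (hxA : pts FA lo hi x) by (now exists u).
        destruct (g' x hx) as (c & d & hcd & [v1 v2] & v3).
        destruct (adj_in _ _ _ hcd) as [hc1 hd1'].
        (* [x] lies between [c] and [d] in height, so separation gives the two sides through [b];
           the side from [c] to [d] comes from [east]. *)
        exists c, d, b. repeat split; auto; try (apply in_or_app; simpl; auto).
        -- rewrite orient_rot. apply hw2; auto.
        -- rewrite <- orient_rot. apply hw2; auto.
      * apply in_map_iff in ht as (u & <- & hu). destruct (q4 _ hu) as [g g'].
        split; [lia|]. intros x hx. rewrite hB in hx.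
        assert (hxB : pts FB lo hi x) by (now exists u).
        destruct (g' x hx) as (c & d & hcd & [v1 v2] & v3).
        apply adj_mirror_back in hcd. rewrite snd_mirror in v1, v2.
        destruct (adj_in _ _ _ hcd) as [hc1 hd1'].
        rewrite <- (snd_mirror d) in v1. rewrite <- (snd_mirror c) in v2.
        rewrite <- (mirrorK c), <- (mirrorK d), orient_mirror in v3.
        exists (mirror d), (mirror c), a.
        split; [apply in_or_app; auto|]. split; [apply in_or_app; auto|].
        split; [apply in_or_app; auto|]. split; [unfold orient in *; nra|].
        split.
        -- rewrite <- orient_rot. apply hw3; auto.
        -- apply hw3; auto.
Qed.

(** Convexity: moving the exponents one step towards each other does not increase the sum, hence the
    induction lowering [d] by 2. *)
Lemma pow2_sum_half u d :
  (2 ^ ((u + (u + d)) / 2) + 2 ^ ((u + (u + d) + 1) / 2) <= 2 ^ u + 2 ^ (u + d))%nat.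
Proof.
  revert u. induction d as [d IH] using lt_wf_ind; intros u.
  destruct d as [|[|d]].
  - replace ((u + (u + 0)) / 2)%nat with u by (apply (Nat.div_unique _ _ _ 0); lia).
    replace ((u + (u + 0) + 1) / 2)%nat with u by (apply (Nat.div_unique _ _ _ 1); lia).
    now rewrite Nat.add_0_r.
  - replace ((u + (u + 1)) / 2)%nat with u by (apply (Nat.div_unique _ _ _ 1); lia).
    replace ((u + (u + 1) + 1) / 2)%nat with (u + 1)%nat
      by (apply (Nat.div_unique _ _ _ 0); lia). lia.
  - specialize (IH d ltac:(lia) (u + 1)%nat).
    replace (u + 1 + (u + 1 + d))%nat with (u + (u + S (S d)))%nat in IH by lia.
    replace (2 ^ (u + 1))%nat with (2 * 2 ^ u)%nat in IH by (rewrite Nat.pow_add_r; simpl; lia).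
    replace (2 ^ (u + 1 + d))%nat with (2 * (2 ^ u * 2 ^ d))%nat in IH
      by (rewrite !Nat.pow_add_r; simpl; lia).
    replace (2 ^ (u + S (S d)))%nat with (4 * (2 ^ u * 2 ^ d))%nat
      by (rewrite Nat.pow_add_r, !Nat.pow_succ_r'; lia).
    pose proof (pow2_pos d). nia.
Qed.

(** Each unit added to the total exponent raises the balanced sum by at least 1. This pays for the
    term p + q being subtracted when p + q exceeds r. *)
Lemma pow2_half_mono k n :
  (2 ^ (k / 2) + 2 ^ ((k + 1) / 2) + n <= 2 ^ ((k + n) / 2) + 2 ^ ((k + n + 1) / 2))%nat.
Proof.
  induction n as [|n IH].
  - rewrite !Nat.add_0_r. lia.
  - assert (2 ^ ((k + n) / 2) + 1 <= 2 ^ ((k + n + 2) / 2))%nat.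
    { replace (k + n + 2)%nat with (k + n + 1 * 2)%nat by lia.
      rewrite Nat.div_add, (Nat.add_1_r ((k + n) / 2)), Nat.pow_succ_r' by lia.
      pose proof (pow2_pos ((k + n) / 2)). lia. }
    replace (k + S n)%nat with (k + n + 1)%nat by lia.
    replace (k + n + 1 + 1)%nat with (k + n + 2)%nat by lia. lia.
Qed.

Lemma pow2_sum_min r p q :
  (2 <= r)%nat -> (1 <= p)%nat -> (1 <= q)%nat -> (r <= p + q)%nat ->
  (2 ^ ((r - 2) / 2) + 2 ^ ((r - 1) / 2) + (p + q - r) <= 2 ^ (p - 1) + 2 ^ (q - 1))%nat.
Proof.
  intros hr hp hq h.
  assert (E := pow2_half_mono (r - 2) (p + q - r)).
  replace (r - 2 + (p + q - r))%nat with (p - 1 + (q - 1))%nat in E by lia.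
  replace (r - 2 + 1)%nat with (r - 1)%nat in E by lia.
  destruct (le_lt_dec p q) as [hpq|hpq].
  - assert (E' := pow2_sum_half (p - 1) (q - p)).
    replace (p - 1 + (q - p))%nat with (q - 1)%nat in E' by lia. lia.
  - assert (E' := pow2_sum_half (q - 1) (p - q)).
    replace (q - 1 + (p - q))%nat with (p - 1)%nat in E' by lia.
    rewrite (Nat.add_comm (q - 1)) in E'. lia.
Qed.

Lemma cfun_nat r : (2 <= r)%nat ->
  cfun r = INR (2 ^ ((r - 2) / 2) + 2 ^ ((r - 1) / 2)) - INR r - 1.
Proof.
  intros hr. unfold cfun, floor_half_m2, ceil_half_m2.
  replace (- ((2 - Z.of_nat r) / 2))%Z with (Z.of_nat ((r - 1) / 2)).
  - replace ((Z.of_nat r - 2) / 2)%Z with (Z.of_nat ((r - 2) / 2)).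
    + rewrite <- !pow_powerRZ, plus_INR, !pow_INR. reflexivity.
    + rewrite Nat2Z.inj_div, Nat2Z.inj_sub by lia. reflexivity.
  - rewrite Nat2Z.inj_div, Nat2Z.inj_sub by lia. change (Z.of_nat 2) with 2%Z.
    change (Z.of_nat 1) with 1%Z.
    pose proof (Z.div_mod (Z.of_nat r - 1) 2). pose proof (Z.mod_pos_bound (Z.of_nat r - 1) 2).
    pose proof (Z.div_mod (2 - Z.of_nat r) 2). pose proof (Z.mod_pos_bound (2 - Z.of_nat r) 2).
    lia.
Qed.

(** The exponent -1 occurs for r < 2, where c(0) = 0 and c(1) = -1/2. Hence the truncated
    subtraction r - 2 is exact wherever it is used. *)
Lemma cfun_pos_ge r : 0 < cfun r -> (2 <= r)%nat.
Proof.
  intros h. destruct r as [|[|r]]; [| |lia]; exfalso; revert h;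
    unfold cfun, floor_half_m2, ceil_half_m2; simpl; lra.
Qed.

(** * Interiors of convex hulls *)

(** Convex combinations with unnormalised weights: total weight 1 gives [in_hull], and arbitrary
    totals allow addition and induction on [s]. *)
Definition in_cone (s : list point) (W X Y : R) : Prop :=
  exists lam : list R,
    length lam = length s /\
    (forall a, In a lam -> 0 <= a) /\
    fold_right Rplus 0 lam = W /\
    fold_right Rplus 0 (map (fun ab => fst ab * fst (snd ab)) (combine lam s)) = X /\
    fold_right Rplus 0 (map (fun ab => fst ab * snd (snd ab)) (combine lam s)) = Y.

Lemma in_cone_zero s : in_cone s 0 0 0.
Proof.
  induction s as [|p s (lam & h1 & h2 & h3 & h4 & h5)].
  - exists []. repeat split; auto. intros a [].
  - exists (0 :: lam). simpl. rewrite h1, h3, h4, h5. repeat split; try ring.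
    intros a [<-|h]; auto. lra.
Qed.

Lemma in_cone_point s u c : In u s -> 0 <= c -> in_cone s c (c * fst u) (c * snd u).
Proof.
  intros hu hc. induction s as [|p s IH]; [easy|]. destruct hu as [->|hu].
  - destruct (in_cone_zero s) as (lam & h1 & h2 & h3 & h4 & h5).
    exists (c :: lam). simpl. rewrite h1, h3, h4, h5. repeat split; try ring.
    intros a [<-|h]; auto.
  - destruct (IH hu) as (lam & h1 & h2 & h3 & h4 & h5).
    exists (0 :: lam). simpl. rewrite h1, h3, h4, h5. repeat split; try ring.
    intros a [<-|h]; auto. lra.
Qed.

Lemma in_cone_add s W X Y W' X' Y' :
  in_cone s W X Y -> in_cone s W' X' Y' -> in_cone s (W + W') (X + X') (Y + Y').
Proof.
  revert W X Y W' X' Y'. induction s as [|p s IH]; intros *.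
  - intros (lam & h1 & _ & <- & <- & <-) (mu & g1 & _ & <- & <- & <-).
    destruct lam, mu; try discriminate. exists []. simpl. repeat split; try ring. intros a [].
  - intros ([|c lam] & h1 & h2 & <- & <- & <-); [discriminate|].
    intros ([|d mu] & g1 & g2 & <- & <- & <-); [discriminate|].
    destruct (IH (fold_right Rplus 0 lam)
      (fold_right Rplus 0 (map (fun ab => fst ab * fst (snd ab)) (combine lam s)))
      (fold_right Rplus 0 (map (fun ab => fst ab * snd (snd ab)) (combine lam s)))
      (fold_right Rplus 0 mu)
      (fold_right Rplus 0 (map (fun ab => fst ab * fst (snd ab)) (combine mu s)))
      (fold_right Rplus 0 (map (fun ab => fst ab * snd (snd ab)) (combine mu s))))
      as (nu & k1 & k2 & k3 & k4 & k5).
    { exists lam. repeat split; auto. intros; apply h2; now right. }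
    { exists mu. repeat split; auto. intros; apply g2; now right. }
    exists (c + d :: nu). simpl. rewrite k1, k3, k4, k5. repeat split; try ring.
    intros a [<-|h]; auto.
    assert (0 <= c) by (apply h2; now left). assert (0 <= d) by (apply g2; now left). lra.
Qed.

(** The barycentric coordinates of [q] are the three orientations divided by their sum [D], each
    attached to the opposite vertex. *)
Lemma in_hull_triangle s u v w q :
  In u s -> In v s -> In w s ->
  0 < orient u v q -> 0 < orient v w q -> 0 < orient w u q -> in_hull s q.
Proof.
  intros hu hv hw h1 h2 h3.
  set (D := orient u v q + orient v w q + orient w u q).
  assert (hD : 0 < D) by (unfold D; lra).
  assert (P := fun p c (hp : In p s) (hc : 0 < c) =>
    in_cone_point s p (c / D) hp (Rlt_le _ _ (Rdiv_lt_0_compat _ _ hc hD))).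
  pose proof (in_cone_add _ _ _ _ _ _ _
    (in_cone_add _ _ _ _ _ _ _ (P u _ hu h2) (P v _ hv h3)) (P w _ hw h1)) as H.
  unfold in_hull, in_cone in *. destruct H as (lam & k1 & k2 & k3 & k4 & k5).
  exists lam. rewrite k3, k4, k5.
  assert (D <> 0) by lra. repeat split; auto.
  - unfold D in *; field; lra.
  - apply (Rmult_eq_reg_r D); auto. transitivity
      (orient v w q * fst u + orient w u q * fst v + orient u v q * fst w); [field; auto|].
    unfold D, orient; ring.
  - apply (Rmult_eq_reg_r D); auto. transitivity
      (orient v w q * snd u + orient w u q * snd v + orient u v q * snd w); [field; auto|].
    unfold D, orient; ring.
Qed.

(** Orientation is affine in its third point, and a displacement below [e] in each coordinate
    changes it by at most e (|A| + |B|), less than its value e (1 + |A| + |B|). *)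
Lemma orient_stable u v q : 0 < orient u v q ->
  exists eps, 0 < eps /\ forall q' : point,
    (fst q' - fst q) ^ 2 + (snd q' - snd q) ^ 2 < eps ^ 2 -> 0 < orient u v q'.
Proof.
  intros h. set (A := fst v - fst u). set (B := snd v - snd u).
  assert (hA := Rabs_pos A). assert (hB := Rabs_pos B).
  set (e := orient u v q / (1 + Rabs A + Rabs B)).
  assert (he : 0 < e) by (apply Rdiv_lt_0_compat; lra).
  assert (hE : e * (1 + Rabs A + Rabs B) = orient u v q) by (unfold e; field; lra).
  exists e. split; auto. intros q' hq.
  set (x := fst q' - fst q) in *. set (y := snd q' - snd q) in *.
  assert (hx : Rabs x <= e) by (apply Rabs_le; nra).
  assert (hy : Rabs y <= e) by (apply Rabs_le; nra).
  assert (E : orient u v q' = orient u v q + A * y - B * x)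
    by (unfold orient, A, B, x, y; ring).
  assert (h1 : - (Rabs A * e) <= A * y).
  { assert (Rabs (A * y) <= Rabs A * e)
      by (rewrite Rabs_mult; apply Rmult_le_compat_l; auto).
    pose proof (Rle_abs (- (A * y))). rewrite Rabs_Ropp in *. lra. }
  assert (h2 : B * x <= Rabs B * e).
  { assert (Rabs (B * x) <= Rabs B * e)
      by (rewrite Rabs_mult; apply Rmult_le_compat_l; auto).
    pose proof (Rle_abs (B * x)). lra. }
  rewrite E, <- hE. lra.
Qed.

Lemma in_triangle_interior s q : in_triangle s q -> in_hull_interior s q.
Proof.
  intros (u & v & w & hu & hv & hw & h1 & h2 & h3).
  destruct (orient_stable _ _ _ h1) as (e1 & p1 & k1).
  destruct (orient_stable _ _ _ h2) as (e2 & p2 & k2).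
  destruct (orient_stable _ _ _ h3) as (e3 & p3 & k3).
  exists (Rmin e1 (Rmin e2 e3)).
  assert (l1 := Rmin_l e1 (Rmin e2 e3)). assert (l2 := Rmin_r e1 (Rmin e2 e3)).
  assert (l3 := Rmin_l e2 e3). assert (l4 := Rmin_r e2 e3).
  assert (hp : 0 < Rmin e1 (Rmin e2 e3)) by (repeat apply Rmin_glb_lt; auto).
  split; auto. intros q' hq. apply (in_hull_triangle s u v w); auto.
  - apply k1. nra.
  - apply k2. nra.
  - apply k3. nra.
Qed.

Lemma is_cup_chain X r s : is_cup X r s -> cup_chain s.
Proof.
  intros [(_ & _ & hx) hs].
  assert (N : forall s1 t k, nth (length s1 + k) (s1 ++ t) pt0 = nth k t pt0)
    by (intros; apply app_nth2_plus).
  assert (hadj : forall a b, adj s a b -> fst a < fst b).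
  { intros a b (s1 & s2 & ->). specialize (hx (length s1)).
    rewrite <- (Nat.add_0_r (length s1)), <- Nat.add_assoc, !N in hx. apply hx.
    rewrite length_app; simpl; lia. }
  split; auto. intros a b c h.
  assert (fst a < fst b /\ fst b < fst c) as [h1 h2].
  { destruct h as (s1 & s2 & ->). split; apply hadj.
    - now exists s1, (c :: s2).
    - exists (s1 ++ [a]), s2. now rewrite <- app_assoc. }
  destruct h as (s1 & s2 & ->). specialize (hs (length s1)).
  rewrite <- (Nat.add_0_r (length s1)), <- !Nat.add_assoc, !N in hs.
  assert (h : slope a b < slope b c) by (apply hs; rewrite length_app; simpl; lia).
  unfold slope in h. unfold orient.
  apply (Rmult_lt_compat_r ((fst b - fst a) * (fst c - fst b))) in h; [|nra].
  replace ((snd b - snd a) / (fst b - fst a) * ((fst b - fst a) * (fst c - fst b)))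
    with ((snd b - snd a) * (fst c - fst b)) in h by (field; lra).
  replace ((snd c - snd b) / (fst c - fst b) * ((fst b - fst a) * (fst c - fst b)))
    with ((snd c - snd b) * (fst b - fst a)) in h by (field; lra).
  nra.
Qed.

Lemma slope_flip p q : slope (flip p) (flip q) = - slope p q.
Proof. unfold slope. rewrite !fst_flip, !snd_flip. unfold Rdiv. ring. Qed.

Lemma is_cap_chain X r s : is_cap X r s -> cup_chain (map flip s).
Proof.
  intros [(h1 & h2 & hx) hs]. apply (is_cup_chain (map flip s) r).
  assert (N : forall j, nth j (map flip s) pt0 = flip (nth j s pt0)).
  (* The default point of [nth] is fixed by [flip], so the identity holds beyond the end of the list
     as well. *)
  { intros j. replace pt0 with (flip pt0) at 1; [apply map_nth|].
    unfold flip, aff, pt0; simpl. f_equal; ring. }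
  split; [split; [|split]|]; rewrite ?length_map; auto.
  - intros j hj. rewrite !N, !fst_flip. auto.
  - intros j hj. rewrite !N, !slope_flip. specialize (hs j hj). lra.
Qed.

(** * General position *)

Definition gen_pos (A : point -> Prop) : Prop :=
  forall p q r, A p -> A q -> A r -> p <> q -> q <> r -> p <> r -> orient p q r <> 0.

Definition xinj (A : point -> Prop) : Prop :=
  forall p q, A p -> A q -> p <> q -> fst p <> fst q.

Lemma gen_pos_aff al c be d A : al <> 0 -> be <> 0 ->
  gen_pos A -> gen_pos (image (aff al c be d) A).
Proof.
  intros ha hb h p q r (p' & hp & ->) (q' & hq & ->) (r' & hr & ->) n1 n2 n3.
  rewrite orient_aff. apply Rmult_integral_contrapositive_currified; [nra|].
  apply h; congruence.
Qed.

(** A mixed triple has two points in one half and one in the other. The two differ in height, so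
    separation decides the sign of the orientation. *)
Lemma gen_pos_join (A B C : point -> Prop) :
  wellsep A B -> yinj A -> yinj B -> gen_pos A -> gen_pos B ->
  (forall p, C p -> A p \/ B p) -> gen_pos C.
Proof.
  intros (h1 & h2 & h3) yA yB gA gB hC.
  assert (hAAB : forall a a' b, A a -> A a' -> B b -> a <> a' -> orient a a' b <> 0).
  { intros a a' b ha ha' hb hn. destruct (Rtotal_order (snd a') (snd a)) as [h|[h|h]].
    - specialize (h2 a a' b ha ha' hb h). lra.
    - apply yA in h; congruence.
    - specialize (h2 a' a b ha' ha hb h). unfold orient in *; nra. }
  assert (hABB : forall a b b', A a -> B b -> B b' -> b <> b' -> orient a b b' <> 0).
  { intros a b b' ha hb hb' hn. destruct (Rtotal_order (snd b) (snd b')) as [h|[h|h]].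
    - specialize (h3 a b b' ha hb hb' h). lra.
    - apply yB in h; congruence.
    - specialize (h3 a b' b ha hb' hb h). unfold orient in *; nra. }
  intros p q r hp hq hr n1 n2 n3.
  destruct (hC p hp) as [kp|kp], (hC q hq) as [kq|kq], (hC r hr) as [kr|kr]; auto.
  - rewrite orient_rot. auto.
  - rewrite <- orient_rot. auto.
  - rewrite <- orient_rot. auto.
  - rewrite orient_rot. auto.
Qed.

Lemma xinj_join (A B C : point -> Prop) :
  (forall a b, A a -> B b -> fst a < fst b) -> xinj A -> xinj B ->
  (forall p, C p -> A p \/ B p) -> xinj C.
Proof.
  intros h xA xB hC p q hp hq n.
  destruct (hC p hp) as [kp|kp], (hC q hq) as [kq|kq]; auto.
  - specialize (h p q kp kq). lra.
  - specialize (h q p kq kp). lra.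
Qed.

Lemma horton_gen_pos Q lo hi F :
  (forall l, Q l -> yinj (fun p => In p l)) -> (forall l, Q l -> gen_pos (fun p => In p l)) ->
  horton Q lo hi F -> stacked F lo hi -> gen_pos (pts F lo hi).
Proof.
  intros hy hg. induction 1 as [i F h|lo hi o o' FA FB F HA IHA HB IHB ho hA hB hw]; intros hs.
  - intros p q r (i1 & e1 & hp) (i2 & e2 & hq) (i3 & e3 & hr).
    replace i1 with i in * by lia. replace i2 with i in * by lia. replace i3 with i in * by lia.
    now apply (hg (F i)).
  - assert (hsA := stacked_half _ _ _ _ _ _ hA hs).
    assert (hsB := stacked_half' _ _ _ _ _ _ hB hs).
    apply gen_pos_join with (1 := hw); auto.
    + eapply horton_yinj; eauto.
    + eapply horton_yinj; eauto.
    + intros p. now apply pts_parity.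
Qed.

Lemma horton_xinj Q lo hi F :
  (forall l, Q l -> xinj (fun p => In p l)) -> horton Q lo hi F -> xinj (pts F lo hi).
Proof.
  intros hx. induction 1 as [i F h|lo hi o o' FA FB F HA IHA HB IHB ho hA hB hw].
  - intros p q (i1 & e1 & hp) (i2 & e2 & hq).
    replace i1 with i in * by lia. replace i2 with i in * by lia. now apply (hx (F i)).
  - apply xinj_join with (A := pts FA lo hi) (B := pts FB lo hi); auto.
    + apply hw.
    + intros p. now apply pts_parity.
Qed.

(** * Placing two sets side by side *)

(** Validity for all small positive factors is stable under finite conjunction, so one contraction
    can meet finitely many strict inequalities. *)
Definition near0 (P : R -> Prop) : Prop :=
  exists e, 0 < e /\ forall al, 0 < al < e -> P al.

Lemma near0_and P Q : near0 P -> near0 Q -> near0 (fun al => P al /\ Q al).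
Proof.
  intros (e & he & h) (e' & he' & h'). exists (Rmin e e').
  split; [now apply Rmin_glb_lt|]. intros al hal.
  pose proof (Rmin_l e e'). pose proof (Rmin_r e e').
  split; [apply h|apply h']; lra.
Qed.

Lemma near0_list {T} (l : list T) (P : T -> R -> Prop) :
  (forall x, In x l -> near0 (P x)) -> near0 (fun al => forall x, In x l -> P x al).
Proof.
  induction l as [|x l IH]; intros h.
  - exists 1. split; [lra|]. intros al _ y [].
  - destruct (near0_and (P x) (fun al => forall y, In y l -> P y al)) as (e & he & h').
    + apply h; now left.
    + apply IH. intros; apply h; now right.
    + exists e. split; auto. intros al hal y hy. destruct (h' al hal) as [k1 k2].
      destruct hy as [<-|hy]; auto.
Qed.

Lemma near0_affine c k : 0 < c -> near0 (fun al => 0 < c + al * k).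
Proof.
  intros hc. pose proof (Rabs_pos k). exists (c / (1 + Rabs k)).
  split; [apply Rdiv_lt_0_compat; lra|]. intros al [h1 h2].
  apply (Rmult_lt_compat_r (1 + Rabs k)) in h2; [|lra].
  replace (c / (1 + Rabs k) * (1 + Rabs k)) with c in h2 by (field; lra).
  pose proof (Rle_abs (- k)). rewrite Rabs_Ropp in *. nra.
Qed.

Lemma near0_imp (H : Prop) P : {H} + {~ H} -> (H -> near0 P) -> near0 (fun al => H -> P al).
Proof.
  intros [h|h] hP; [destruct (hP h) as (e & he & h'); exists e; auto|].
  exists 1. split; [lra|]. easy.
Qed.

(** Squeezing the sets horizontally towards the lines x = 0 and x = 1 makes their own lines almost
    vertical, while heights stay as prescribed by [be], [d] and [d']. Every required quantity is
    affine in [al] and positive at [al] = 0. *)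
Lemma wellsep_exists (A B : list point) be d d' : 0 < be ->
  exists al, 0 < al /\
    wellsep (fun p => In p (map (aff al 0 be d) A)) (fun p => In p (map (aff al 1 be d') B)).
Proof.
  intros hbe.
  assert (h : near0 (fun al =>
    (forall a, In a A -> forall b, In b B -> 0 < 1 + al * (fst b - fst a)) /\
    (forall a, In a A -> forall a', In a' A -> forall b, In b B -> snd a' < snd a ->
       0 < be * (snd a - snd a') + al * ((fst a' - fst a) * (be * snd b + d' - be * snd a - d)
         - be * (snd a' - snd a) * (fst b - fst a))) /\
    (forall a, In a A -> forall b, In b B -> forall b', In b' B -> snd b < snd b' ->
       0 < be * (snd b' - snd b) +
         al * ((fst b - fst a) * (be * snd b' + d' - be * snd a - d)
         - (be * snd b + d' - be * snd a - d) * (fst b' - fst a))))).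
  { repeat apply near0_and; repeat (apply near0_list; intros).
    - apply near0_affine; lra.
    - apply near0_imp; [apply Rlt_dec|]. intros. apply near0_affine. nra.
    - apply near0_imp; [apply Rlt_dec|]. intros. apply near0_affine. nra. }
  destruct h as (e & he & h). specialize (h (e / 2) ltac:(lra)) as (h1 & h2 & h3).
  exists (e / 2). split; [lra|].
  set (al := e / 2) in *. split; [|split].
  - intros a b ha hb.
    apply in_map_iff in ha as (a' & <- & ha), hb as (b' & <- & hb).
    specialize (h1 a' ha b' hb). unfold aff; simpl. lra.
  - intros a1 a2 b ha1 ha2 hb hlt.
    apply in_map_iff in ha1 as (a1' & <- & ha1), ha2 as (a2' & <- & ha2),
      hb as (b' & <- & hb).
    unfold aff in hlt; simpl in hlt.
    assert (hal : 0 < al) by (unfold al; lra).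
    specialize (h2 a1' ha1 a2' ha2 b' hb ltac:(nra)).
    eapply Rlt_le_trans; [apply (Rmult_lt_0_compat 1 _ ltac:(lra) h2)|].
    right. unfold orient, aff; simpl. ring.
  - intros a b1 b2 ha hb1 hb2 hlt.
    apply in_map_iff in ha as (a' & <- & ha), hb1 as (b1' & <- & hb1),
      hb2 as (b2' & <- & hb2).
    unfold aff in hlt; simpl in hlt.
    specialize (h3 a' ha b1' hb1 b2' hb2 ltac:(nra)).
    eapply Rlt_le_trans; [exact h3|].
    right. unfold orient, aff; simpl. ring.
Qed.

(** * Steep Erdos-Szekeres sets *)

(** C(a+b, a) by the Pascal rule, which is also the gluing rule for the sets. The inner recursion is
    needed because each call lowers only one of the two arguments. *)
Fixpoint es_size (a : nat) : nat -> nat :=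
  match a with
  | O => fun _ => 1%nat
  | S a' => fix go b := match b with O => 1%nat | S b' => (es_size a' b + go b')%nat end
  end.

Lemma es_size_pos a b : (1 <= es_size a b)%nat.
Proof.
  revert b. induction a as [|a IH]; intros b; simpl; auto.
  destruct b; auto. specialize (IH (S b)). lia.
Qed.

Lemma C_n_0 n : Binomial.C n 0 = 1.
Proof. unfold Binomial.C. rewrite Nat.sub_0_r. simpl. field. apply INR_fact_neq_0. Qed.

Lemma C_n_n n : Binomial.C n n = 1.
Proof. rewrite pascal_step1 by lia. now rewrite Nat.sub_diag, C_n_0. Qed.

Lemma es_size_binomial a b : INR (es_size a b) = Binomial.C (a + b) a.
Proof.
  revert b. induction a as [|a IHa]; intros b.
  - simpl. now rewrite C_n_0.
  - induction b as [|b IHb].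
    + rewrite Nat.add_0_r, C_n_n. reflexivity.
    + change (es_size (S a) (S b)) with (es_size a (S b) + es_size (S a) b)%nat.
      rewrite plus_INR, IHa, IHb. replace (S a + S b)%nat with (S (S a + b)) by lia.
      rewrite <- pascal by lia. do 2 f_equal. lia.
Qed.

(** Monotonicity is the addition to the classical cup and cap bounds: it prevents a descending chain
    from using two points of a cell. *)
Definition es_set (a b : nat) (l : list point) : Prop :=
  NoDup l /\ length l = es_size a b /\
  xinj (fun p => In p l) /\
  (forall p q, In p l -> In q l -> fst p < fst q -> snd p < snd q) /\
  gen_pos (fun p => In p l) /\
  (forall s, (forall p, In p s -> In p l) -> cup_chain s -> (length s <= a + 1)%nat) /\
  (forall s, (forall p, In p s -> In p l) -> cup_chain (map flip s) -> (length s <= b + 1)%nat).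

Lemma es_set_yinj a b l : es_set a b l -> yinj (fun p => In p l).
Proof.
  intros (_ & _ & hx & hm & _) p q hp hq E.
  destruct (Rtotal_order (fst p) (fst q)) as [h|[h|h]].
  - specialize (hm p q hp hq h). lra.
  - destruct p, q; simpl in *; congruence.
  - specialize (hm q p hq hp h). lra.
Qed.

Lemma sublist_map (f : point -> point) l s :
  (forall p, In p s -> In p (map f l)) ->
  exists s', s = map f s' /\ forall p, In p s' -> In p l.
Proof.
  induction s as [|p s IH]; intros h.
  - exists []. split; auto. intros p [].
  - destruct IH as (s' & -> & h'); [intros; apply h; now right|].
    assert (hp := h p (or_introl eq_refl)). apply in_map_iff in hp as (q & <- & hq).
    exists (q :: s'). split; auto. intros r [<-|hr]; auto.
Qed.

Lemma flip_aff al c be d p : flip (aff al c be d p) = aff al c be (- d) (flip p).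
Proof. unfold flip, aff; simpl. f_equal; ring. Qed.

Lemma image_map f l p : In p (map f l) -> image f (fun p => In p l) p.
Proof. intros h. apply in_map_iff in h as (q & <- & hq). now exists q. Qed.

Lemma es_set_aff a b al c be d l :
  0 < al -> 0 < be -> es_set a b l -> es_set a b (map (aff al c be d) l).
Proof.
  intros hal hbe (h1 & h2 & h3 & h4 & h5 & h6 & h7).
  split; [|split; [|split; [|split; [|split; [|split]]]]].
  - apply Injective_map_NoDup; auto. intros p q. apply aff_inj; lra.
  - now rewrite length_map.
  - intros p q hp hq hn. apply in_map_iff in hp as (p' & <- & hp), hq as (q' & <- & hq).
    assert (fst p' <> fst q') by (apply h3; congruence).
    unfold aff; simpl. intros E. apply H, (Rmult_eq_reg_l al); lra.
  - intros p q hp hq. apply in_map_iff in hp as (p' & <- & hp), hq as (q' & <- & hq).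
    unfold aff; simpl. intros hlt. assert (snd p' < snd q') by (apply h4; auto; nra). nra.
  - intros p q r hp hq hr.
    apply (gen_pos_aff al c be d) in h5; try lra. apply h5; now apply image_map.
  - intros s hs hc. apply sublist_map in hs as (s' & -> & hs).
    rewrite length_map. apply h6; auto. now apply cup_chain_aff in hc.
  - intros s hs hc. apply sublist_map in hs as (s' & -> & hs).
    rewrite length_map. apply h7; auto.
    rewrite map_map in hc. rewrite (map_ext _ _ (flip_aff al c be d)) in hc.
    rewrite <- map_map in hc. now apply cup_chain_aff in hc.
Qed.

Lemma increasing_chain_short (A : point -> Prop) s :
  (forall p q, A p -> A q -> fst p < fst q -> snd p < snd q) ->
  (forall p, In p s -> A p) -> (forall p q, adj s p q -> fst p < fst q) ->
  (forall p q, adj s p q -> snd q < snd p) -> (length s <= 1)%nat.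
Proof.
  intros hA hs hx hy. destruct s as [|p [|q s]]; simpl; try lia. exfalso.
  assert (h : adj (p :: q :: s) p q) by (now exists [], s).
  specialize (hx p q h). specialize (hy p q h).
  specialize (hA p q (hs p (or_introl eq_refl)) (hs q (or_intror (or_introl eq_refl))) hx).
  lra.
Qed.

Lemma snd_bounded (l : list point) : exists M, 0 < M /\ forall p, In p l -> Rabs (snd p) < M.
Proof.
  induction l as [|p l (M & hM & h)].
  - exists 1. split; [lra|]. intros p [].
  - exists (M + Rabs (snd p) + 1). pose proof (Rabs_pos (snd p)).
    split; [lra|]. intros q [<-|hq]; [lra|]. specialize (h q hq). lra.
Qed.

Lemma adj_cons_last (s1 s2 : list point) b : s1 <> [] ->
  exists t a, s1 = t ++ [a] /\ s1 ++ b :: s2 = t ++ (a :: b :: s2) /\ In a s1.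
Proof.
  intros h. destruct (exists_last h) as (t & a & ->). exists t, a.
  rewrite <- app_assoc. repeat split. apply in_or_app; simpl; auto.
Qed.

(** A cup meeting both parts descends in [A], so it has one point there besides at most a + 1 in
    [B]. A cap meeting both descends in [B], so it has one point there besides at most b + 1 in
    [A]. *)
Lemma es_set_join a b A B :
  es_set (S a) b A -> es_set a (S b) B ->
  wellsep (fun p => In p A) (fun p => In p B) ->
  (forall p q, In p A -> In q B -> snd p < snd q) -> es_set (S a) (S b) (A ++ B).
Proof.
  intros HA HB hw hAB.
  assert (yA := es_set_yinj _ _ _ HA). assert (yB := es_set_yinj _ _ _ HB).
  destruct HA as (a1 & a2 & a3 & a4 & a5 & a6 & a7).
  destruct HB as (b1 & b2 & b3 & b4 & b5 & b6 & b7).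
  assert (hin : forall p, In p (A ++ B) -> In p A \/ In p B) by (intros; now apply in_app_or).
  assert (hlt : forall p q, In p A -> In q B -> fst p < fst q) by apply hw.
  split; [|split; [|split; [|split; [|split; [|split]]]]].
  - apply NoDup_app; auto. intros p hp hp'. specialize (hAB p p hp hp'). lra.
  - rewrite length_app, a2, b2. simpl. lia.
  - now apply xinj_join with (1 := hlt).
  - intros p q hp hq h. apply hin in hp as [hp|hp], hq as [hq|hq]; auto.
    specialize (hlt q p hq hp). lra.
  - now apply gen_pos_join with (1 := hw).
  - intros s hs hc.
    destruct (increasing_split (fun p => In p A) (fun p => In p B) s)
      as (s1 & s2 & -> & k1 & k2); auto.
    { apply hc. }
    destruct s2 as [|q s2].
    { rewrite app_nil_r in *. apply a6 in hc; auto. }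
    assert (l2 : (length (q :: s2) <= a + 1)%nat).
    { apply b6; auto. now apply cup_chain_app_r in hc. }
    assert (l1 : (length s1 <= 1)%nat); [|rewrite length_app; lia].
    apply (increasing_chain_short (fun p => In p A)); auto.
    + intros u v huv. apply hc. now apply adj_app_l.
    + apply (wellsep_prefix_descending _ _ s1 q hw yA); auto.
      * apply (cup_chain_app_l _ s2). now rewrite <- app_assoc.
      * apply k2; simpl; auto.
  - intros s hs hc.
    destruct (increasing_split (fun p => In p A) (fun p => In p B) s)
      as (s1 & s2 & -> & k1 & k2); auto.
    { intros u v (x & y & ->). rewrite <- (fst_flip u), <- (fst_flip v). apply hc.
      exists (map flip x), (map flip y). now rewrite map_app. }
    destruct s1 as [|p s1]; [simpl app in *; apply b7 in hc; auto; lia|].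
    rewrite length_app.
    assert (l1 : (length (p :: s1) <= b + 1)%nat).
    { apply a7; auto. rewrite map_app in hc. now apply cup_chain_app_l in hc. }
    assert (l2 : (length s2 <= 1)%nat); [|lia].
    destruct s2 as [|q s2]; [simpl; lia|].
    destruct (adj_cons_last (p :: s1) s2 q) as (t & z & E & E' & hz); [easy|].
    rewrite E' in hc. rewrite map_app in hc. apply cup_chain_app_r in hc.
    (* The flipped cap is a cup, so its right part ascends; undoing the flip, the cap descends in
       the increasing set [B]. *)
    assert (hd : descending (rev (map mirror (map flip (q :: s2))))).
    { apply (wellsep_suffix_ascending _ _ _ (flip z) (wellsep_flip _ _ hw)).
      - intros u v (u' & hu & ->) (v' & hv & ->). rewrite !snd_flip. intros h.
        f_equal. apply yB; auto. lra.
      - exact hc.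
      - exists z. auto.
      - intros u hu. apply image_map in hu as (u' & hu & ->). exists u'. auto. }
    assert (hadj : forall u v, adj (q :: s2) u v -> adj (map flip (q :: s2)) (flip u) (flip v)).
    { intros u v (x & y & ->). exists (map flip x), (map flip y). now rewrite map_app. }
    apply (increasing_chain_short (fun p => In p B)); auto.
    + intros u v huv. apply hadj in huv. rewrite <- (fst_flip u), <- (fst_flip v).
      apply hc. now apply (adj_app_r [flip z]).
    + intros u v huv. apply hadj in huv. apply (descending_rev_mirror _ _ _ hd) in huv.
      rewrite !snd_flip in huv. lra.
Qed.

Lemma es_set_single a b : es_size a b = 1%nat -> es_set a b [pt0].
Proof.
  intros hs.
  assert (hshort : forall s, (forall p, In p s -> In p [pt0]) ->
            (forall u v, adj s u v -> fst u < fst v) -> (length s <= 1)%nat).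
  { intros s h hx. apply (increasing_chain_short (fun p => In p [pt0])); auto.
    - intros p q [<-|[]] [<-|[]]. lra.
    - intros p q hpq. assert (hlt := hx p q hpq). destruct (adj_in _ _ _ hpq) as [hp hq].
      apply h in hp as [<-|[]]. apply h in hq as [<-|[]]. lra. }
  split; [|split; [|split; [|split; [|split; [|split]]]]].
  - constructor; [easy|constructor].
  - now rewrite hs.
  - intros p q [<-|[]] [<-|[]]. easy.
  - intros p q [<-|[]] [<-|[]]. lra.
  - intros p q r [<-|[]] [<-|[]]. easy.
  - intros s h hc. assert (length s <= 1)%nat; [|lia]. apply hshort; auto. apply hc.
  - intros s h hc. assert (length s <= 1)%nat; [|lia]. apply hshort; auto.
    intros u v (x & y & ->). rewrite <- (fst_flip u), <- (fst_flip v). apply hc.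
    exists (map flip x), (map flip y). now rewrite map_app.
Qed.

Lemma es_set_exists a b : exists l, es_set a b l.
Proof.
  revert b. induction a as [|a IHa]; intros b.
  - exists [pt0]. now apply es_set_single.
  - induction b as [|b (A & HA)].
    + exists [pt0]. now apply es_set_single.
    + destruct (IHa (S b)) as (B & HB).
      destruct (snd_bounded A) as (M & hM & hA). destruct (snd_bounded B) as (M' & hM' & hB).
      (* The shift by M + M' lifts all of [B] above height M, hence above [A]. *)
      destruct (wellsep_exists A B 1 0 (M + M')) as (al & hal & hw); [lra|].
      exists (map (aff al 0 1 0) A ++ map (aff al 1 1 (M + M')) B).
      apply es_set_join; auto; try (apply es_set_aff; auto; lra).
      intros p q hp hq. apply in_map_iff in hp as (p' & <- & hp), hq as (q' & <- & hq).
      apply hA, Rabs_def2 in hp. apply hB, Rabs_def2 in hq. unfold aff; simpl. lra.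
Qed.

Lemma es_set_cup_bounded a b l : es_set a b l -> cup_bounded 0 a l.
Proof.
  intros H. assert (hy := es_set_yinj _ _ _ H). destruct H as (_ & _ & hx & hm & _ & hcup & _).
  split; [auto|]. split; [|split; intros; apply hcup; auto].
  intros s hs hc hd. apply (increasing_chain_short (fun p => In p l)); auto. apply hc.
Qed.

(** Cups of [l] are caps of the flipped set, whence [b]. As [l] is decreasing, the roles of the two
    sides are exchanged: ascending chains have at most one point. *)
Lemma es_set_flip_cup_bounded a b l : es_set a b (map flip l) -> cup_bounded b 0 l.
Proof.
  intros H. assert (hy := es_set_yinj _ _ _ H). destruct H as (_ & _ & hx & hm & _ & _ & hcap).
  assert (hb : forall s, (forall p, In p s -> In p l) -> cup_chain s -> (length s <= b + 1)%nat).
  { intros s hs hc. rewrite <- (length_map flip). apply hcap; [|now rewrite map_flipK].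
    intros p hp. apply in_map_iff in hp as (q & <- & hq). apply in_map. auto. }
  split; [|split; [auto|split]].
  - intros p q hp hq E. rewrite <- (flipK p), <- (flipK q). f_equal.
    apply hy; try now apply in_map. rewrite !snd_flip. lra.
  - intros s hs hc hd.
    rewrite <- (length_map flip).
    apply (increasing_chain_short (fun p => In p (map flip l))); auto.
    + intros p hp. apply in_map_iff in hp as (q & <- & hq). apply in_map. auto.
    + intros p q h. apply adj_map in h as (p' & q' & -> & -> & h). rewrite !fst_flip.
      now apply hc.
    + intros p q h. apply adj_map in h as (p' & q' & -> & -> & h). rewrite !snd_flip.
      apply (descending_rev_mirror _ _ _ hd) in h. lra.
  - intros s hs hc. rewrite Nat.add_0_r. auto.
Qed.

(** * Rotated Horton sets with Erdos-Szekeres cells *)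

Definition zrange (lo hi : Z) : list Z :=
  map (fun k => (lo + Z.of_nat k)%Z) (seq 0 (Z.to_nat (hi - lo + 1))).

Lemma in_zrange lo hi i : In i (zrange lo hi) <-> (lo <= i <= hi)%Z.
Proof.
  unfold zrange. rewrite in_map_iff. split.
  - intros (k & <- & hk). apply in_seq in hk. lia.
  - intros h. exists (Z.to_nat (i - lo)). rewrite in_seq. lia.
Qed.

Lemma zrange_NoDup lo hi : NoDup (zrange lo hi).
Proof. apply Injective_map_NoDup; [intros x y; lia|apply seq_NoDup]. Qed.

Lemma in_cells F lo hi p : In p (flat_map F (zrange lo hi)) <-> pts F lo hi p.
Proof.
  rewrite in_flat_map. split; intros (i & h1 & h2); exists i; split; auto;
    now apply in_zrange.
Qed.

Lemma es_set_flat a b l w : es_set a b l -> 0 < w ->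
  exists l', es_set a b l' /\ forall p, In p l' -> 0 <= snd p < w.
Proof.
  intros H hw. destruct (snd_bounded l) as (M & hM & h).
  assert (hq : 0 < w / (2 * M)) by (apply Rdiv_lt_0_compat; lra).
  (* This map carries heights from (-M, M) onto (0, w). *)
  exists (map (aff 1 0 (w / (2 * M)) (w / 2)) l). split.
  - apply es_set_aff; auto; lra.
  - intros p hp. apply in_map_iff in hp as (q & <- & hp). apply h, Rabs_def2 in hp.
    unfold aff; simpl. set (z := w / (2 * M)) in *.
    replace (w / 2) with (z * M) by (unfold z; field; lra).
    replace w with (2 * (z * M)) at 1 by (unfold z; field; lra). nra.
Qed.

(** Two copies, stretched vertically by 2 and one of them raised by 1, become the even and odd
    cells. Stretching doubles the thickness of the cells, so the induction is over all [w] and the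
    step starts from w / 2. *)
Lemma horton_exists a b k w : 0 < w ->
  exists F, horton (es_set a b) 0 (2 ^ Z.of_nat k - 1) F /\
    forall i p, (0 <= i <= 2 ^ Z.of_nat k - 1)%Z -> In p (F i) -> IZR i <= snd p < IZR i + w.
Proof.
  revert w. induction k as [|k IH]; intros w hw.
  - destruct (es_set_exists a b) as (l0 & H0). destruct (es_set_flat a b l0 w H0 hw) as (l & H & h).
    exists (fun _ => l). split; [now constructor|]. intros i p hi hp.
    replace i with 0%Z by (simpl in hi; lia). specialize (h p hp). lra.
  - destruct (IH (w / 2)) as (F & HF & hF); [lra|]. clear IH.
    set (hi := (2 ^ Z.of_nat k - 1)%Z) in *.
    assert (E : (2 ^ Z.of_nat (S k) - 1 = 2 * hi + 1)%Z).
    { unfold hi. rewrite Nat2Z.inj_succ, Z.pow_succ_r by lia. lia. }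
    rewrite E.
    destruct (wellsep_exists (flat_map F (zrange 0 hi)) (flat_map F (zrange 0 hi)) 2 0 1)
      as (al & hal & hsep); [lra|].
    set (FA := fun i => map (aff al 0 2 0) (F i)). set (FB := fun i => map (aff al 1 2 1) (F i)).
    exists (fun i => if Z.even i then FA (i / 2)%Z else FB (i / 2)%Z). split.
    + replace 0%Z with (2 * 0 + Z.min 0 1)%Z by reflexivity.
      replace (2 * hi + 1)%Z with (2 * hi + Z.max 0 1)%Z by reflexivity.
      apply horton_node with FA FB.
      * apply (horton_aff (es_set a b)); auto; try lra. intros; apply es_set_aff; auto; lra.
      * apply (horton_aff (es_set a b)); auto; try lra. intros; apply es_set_aff; auto; lra.
      * lia.
      * intros i. rewrite Z.add_0_r, Z.even_mul. change (Z.even 2) with true.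
        cbv beta iota delta [orb]. f_equal. rewrite Z.mul_comm. apply Z.div_mul. lia.
      * intros i. rewrite Z.even_add, Z.even_mul. change (Z.even 2) with true.
        cbn [orb Z.even Bool.eqb]. f_equal. rewrite Z.mul_comm, Z.div_add_l by lia.
        change (1 / 2)%Z with 0%Z. lia.
      * revert hsep. apply wellsep_ext; intros p (i & hi' & hp);
          apply in_map_iff in hp as (q & <- & hq); apply in_map, in_cells; now exists i.
    + intros i p hi' hp. assert (hdm := Z.div_mod i 2 ltac:(lia)).
      rewrite Zmod_even in hdm. set (j := (i / 2)%Z) in *.
      destruct (Z.even i); apply in_map_iff in hp as (q & <- & hq);
        apply hF in hq; try lia; rewrite hdm, plus_IZR, mult_IZR; unfold aff; simpl; lra.
Qed.

Lemma flat_map_cells_NoDup (F : Z -> list point) L :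
  NoDup L -> (forall i, In i L -> NoDup (F i)) ->
  (forall i j p, In i L -> In j L -> In p (F i) -> In p (F j) -> i = j) ->
  NoDup (flat_map F L).
Proof.
  induction L as [|i L IH]; intros h1 h2 h3; simpl; [constructor|].
  inversion h1; subst. apply NoDup_app.
  - apply h2; now left.
  - apply IH; auto.
    + intros; apply h2; now right.
    + intros j k p hj hk; apply h3; now right.
  - intros p hp hp'. apply in_flat_map in hp' as (j & hj & hp').
    assert (i = j) by (apply (h3 i j p); simpl; auto). subst. auto.
Qed.

Lemma horton_cells_NoDup a b lo hi F L :
  horton (es_set a b) lo hi F -> stacked F lo hi ->
  NoDup L -> (forall i, In i L -> (lo <= i <= hi)%Z) ->
  NoDup (flat_map F L) /\ length (flat_map F L) = (length L * es_size a b)%nat.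
Proof.
  intros HF hs hL hin. split.
  - apply flat_map_cells_NoDup; auto.
    + intros i hi'. apply (horton_cell _ _ _ _ i HF). auto.
    + intros i j p hi' hj hp hq. apply hin in hi', hj.
      destruct (Z.lt_total i j) as [h|[h|h]]; auto; exfalso.
      * assert (snd p < snd p) by (apply (hs i j); auto; lia). lra.
      * assert (snd p < snd p) by (apply (hs j i); auto; lia). lra.
  - rewrite (flat_map_constant_length (c := es_size a b)); auto.
    intros i hi'. apply (horton_cell _ _ _ _ i HF). auto.
Qed.

(** The minimum over [p] and [q] gives at least c(r) + 1 cells, and disjoint cells of equal size
    turn this into more points than the bound. *)
Lemma many_inside a b lo hi F s r cells p q :
  horton (es_set a b) lo hi F -> stacked F lo hi -> (2 <= r)%nat ->
  NoDup cells ->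
  (forall t, In t cells -> (lo <= t <= hi)%Z /\ forall x, In x (F t) -> in_triangle s x) ->
  (1 <= p)%nat -> (1 <= q)%nat -> (r <= p + q)%nat ->
  (2 ^ (p - 1) + 2 ^ (q - 1) <= length cells + p + q)%nat ->
  ~ at_most_inside (flat_map F (zrange lo hi)) s (cfun r * INR (es_size a b) - 1).
Proof.
  intros HF hs hr hN hcells hp hq hpq hlen hmost.
  destruct (horton_cells_NoDup a b lo hi F cells) as [h1 h2]; auto.
  { intros i hi'. now apply hcells. }
  assert (H : INR (length (flat_map F cells)) <= cfun r * INR (es_size a b) - 1).
  { apply hmost; auto. intros x hx. apply in_flat_map in hx as (t & ht & hx).
    destruct (hcells t ht) as [k1 k2]. split.
    - apply in_cells. now exists t.
    - apply in_triangle_interior. auto. }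
  rewrite h2, mult_INR, cfun_nat in H by auto.
  assert (hmin := pow2_sum_min r p q hr hp hq hpq).
  assert (hc : INR (2 ^ ((r - 2) / 2) + 2 ^ ((r - 1) / 2)) <= INR (length cells) + INR r).
  { rewrite <- plus_INR. apply le_INR. lia. }
  assert (hn : 1 <= INR (es_size a b)) by (apply (le_INR 1), es_size_pos).
  set (n := INR (es_size a b)) in *. nra.
Qed.

Theorem mainTheorem5 (l0 m0 l m : nat)
  (hl0 : 0 < cfun l0) (hm0 : 0 < cfun m0)
  (hl : (5 <= l)%nat) (hm : (5 <= m)%nat)
  (hll0 : (l0 <= l)%nat) (hmm0 : (m0 <= m)%nat) :
  let l1 := cfun l0 * Binomial.C (l + m - l0 - m0) (l - l0) - 1 in
  let m1 := cfun m0 * Binomial.C (l + m - l0 - m0) (m - m0) - 1 in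
  forall N : nat, (1 <= N)%nat ->
    exists X : list point,
      NoDup X /\ (N <= length X)%nat /\
      general_position X /\ distinct_x X /\
      (forall s, is_cup X l s -> ~ at_most_inside X s l1) /\
      (forall s, is_cap X m s -> ~ at_most_inside X s m1).
Proof.
  intros l1 m1 N hN.
  assert (rl := cfun_pos_ge _ hl0). assert (rm := cfun_pos_ge _ hm0).
  set (a := (l - l0)%nat). set (b := (m - m0)%nat).
  assert (El : l1 = cfun l0 * INR (es_size a b) - 1).
  { unfold l1. rewrite es_size_binomial. do 3 f_equal. unfold a, b. lia. }
  assert (Em : m1 = cfun m0 * INR (es_size a b) - 1).
  (* The cap bound involves C(a+b, b), so the symmetry of binomial coefficients is used. *)
  { unfold m1. rewrite es_size_binomial, pascal_step1 by lia.
    do 3 f_equal; unfold a, b; lia. }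
  rewrite El, Em. clear l1 m1 El Em.
  (* Thickness 1 keeps cells with integer base heights disjoint, and depth [N] yields 2^N > N
     cells. *)
  destruct (horton_exists a b N 1) as (F & HF & hF); [lra|].
  set (hi := (2 ^ Z.of_nat N - 1)%Z) in *.
  assert (hs : stacked F 0 hi).
  { intros i j p q h1 h2 h3 hp hq. apply hF in hp; [|lia]. apply hF in hq; [|lia].
    assert (IZR i + 1 <= IZR j) by (rewrite <- plus_IZR; apply IZR_le; lia). lra. }
  destruct (horton_cells_NoDup a b 0 hi F (zrange 0 hi)) as [hnd hlen]; auto.
  { apply zrange_NoDup. }
  { intros i. apply in_zrange. }
  exists (flat_map F (zrange 0 hi)).
  assert (hin := in_cells F 0 hi).
  split; [exact hnd|]. split; [|split; [|split; [|split]]].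
  - rewrite hlen. unfold zrange. rewrite length_map, length_seq.
    assert (Z.of_nat N < 2 ^ Z.of_nat N)%Z by (apply Z.pow_gt_lin_r; lia).
    pose proof (es_size_pos a b). unfold hi. nia.
  - intros p q r hp hq hr. apply hin in hp, hq, hr. revert p q r hp hq hr.
    change (gen_pos (pts F 0 hi)). apply (horton_gen_pos (es_set a b)); auto.
    + intros l'. apply es_set_yinj.
    + intros l' (_ & _ & _ & _ & h & _). exact h.
  - intros p q hp hq. apply hin in hp, hq. revert p q hp hq.
    change (xinj (pts F 0 hi)). apply (horton_xinj (es_set a b)); auto.
    intros l' (_ & _ & h & _). exact h.
  - intros s hcup.
    (* The surplus a = l - l0 leaves exactly r = l0. *)
    destruct (cup_count _ 0 a 0 hi F (es_set_cup_bounded a b) HF hs s l0)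
      as (L & p & q & h1 & h2 & h3 & h4 & h5 & h6); auto.
    + intros p hp. apply hin. now apply hcup.
    + now apply is_cup_chain in hcup.
    + destruct hcup as [[-> _] _]. unfold a. lia.
    + apply (many_inside a b 0 hi F s l0 L p q); auto.
  - intros s hcap.
    destruct (cup_count _ b 0 _ _ _ (es_set_flip_cup_bounded a b) (horton_flip _ _ _ _ HF))
      with (s := map flip s) (r := m0)
      as (L & p & q & h1 & h2 & h3 & h4 & h5 & h6); auto.
    + intros i j p q h1 h2 h3 hp hq.
      apply in_map_iff in hp as (p' & <- & hp), hq as (q' & <- & hq).
      rewrite !snd_flip.
      assert (snd q' < snd p') by (apply (hs (- j)%Z (- i)%Z); auto; lia). lra.
    + intros p hp. apply in_map_iff in hp as (p' & <- & hp).
      apply hcap, hin in hp as (i & hi' & hp). exists (- i)%Z. split; [lia|].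
      apply in_map. now rewrite Z.opp_involutive.
    + now apply is_cap_chain in hcap.
    + rewrite length_map. destruct hcap as [[-> _] _]. unfold b. lia.
    (* The cells were found in the upside-down stack, so their indices are negated to return to
       [F]. *)
    + apply (many_inside a b 0 hi F s m0 (map Z.opp L) p q); auto.
      * apply Injective_map_NoDup; auto. intros x y; lia.
      * intros t ht. apply in_map_iff in ht as (u & <- & hu). destruct (h2 u hu) as [k1 k2].
        split; [lia|]. intros x hx. apply in_triangle_flip. apply k2. now apply in_map.
      * now rewrite length_map.
Qed.
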